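(* Let $H$ be a real separable symplectic Hilbert space with compatible symplectic form, inner product and almost complex structure $J$, and let $\mathbf{d}:[0,1]\to\mathcal{U}_{\mathcal{F}}(H_J)$ be a continuous path. Consider data consisting of a partition $0=t_0<t_1<\dots<t_N=1$ and numbers $0<\varepsilon_j<\pi$ ($j=1,\dots,N$) such that for every $j$ and every $t\in[t_{j-1},t_j]$: (i) $e^{\sqrt{-1}(\pi\pm\varepsilon_j)}$ belong to the resolvent set of $\mathbf{d}(t)$; (ii) $\sum_{|\theta|\le\varepsilon_j}\dim\operatorname{Ker}(\mathbf{d}(t)-e^{\sqrt{-1}(\pi+\theta)})<\infty$. For such data set $$\mathbf{M}(\{\mathbf{d}(t)\})=\sum_{j=1}^N\bigl(k(t_j,\varepsilon_j)-k(t_{j-1},\varepsilon_j)\bigr),\qquad k(t,\varepsilon_j)=\sum_{0\le\theta\le\varepsilon_j}\dim\operatorname{Ker}(\mathbf{d}(t)-e^{\sqrt{-1}(\pi+\theta)})\quad(t_{j-1}\le t\le t_j).$$ Then the quantity $\mathbf{M}(\{\mathbf{d}(t)\})$ does not depend on the choice of the partition $\{t_j\}_{j=0}^N$ of $[0,1]$ nor on the choice of the positive numbers $\{\varepsilon_j\}_{j=1}^N$ satisfying (i) and (ii).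
   Context: Compatible means $\omega(x,y)=\langle Jx,y\rangle$ with $J$ orthogonal and $J^2=-\mathrm{Id}$. $H_J$ is $H$ viewed as a complex Hilbert space via $J$ with Hermitian inner product $\langle\cdot,\cdot\rangle-\sqrt{-1}\,\omega(\cdot,\cdot)$, and $\mathcal{U}(H_J)$ is its unitary group with the operator norm topology. $\mathcal{U}_{\mathcal{F}}(H_J)=\{U\in\mathcal{U}(H_J): U+\mathrm{Id}\text{ is a Fredholm operator}\}$. Dimensions of kernels are complex dimensions. The integer $\mathbf{M}(\{\mathbf{d}(t)\})$ is called the unitary Maslov index of the path.
   Formalization: Condition (ii) is strengthened: besides the finite sum, every point of the spectrum of d(t) in the arc |θ| ≤ ε_j around −1 must be an eigenvalue; with bare finiteness of the kernel dimensions, continuous spectrum in the arc makes the claim false. *)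

(* Defs.v *)
From HB Require Import structures.
From mathcomp Require Import all_boot all_order all_algebra.
From mathcomp Require Import all_classical all_reals all_analysis.
From mathcomp Require Import complex ring.

Set Implicit Arguments.
Unset Strict Implicit.
Unset Printing Implicit Defensive.

Import Order.TTheory GRing.Theory Num.Theory.
Import numFieldNormedType.Exports.

Local Open Scope classical_set_scope.
Local Open Scope complex_scope.
Local Open Scope ring_scope.

Definition separable (T : topologicalType) : Prop :=
  exists2 D : set T, countable D & dense D.

(* A real symplectic Hilbert space with compatible data: the norm of the
   complete normed space [H] is the one induced by [ip]. *)
Record compatible_symplectic (R : realType) (H : completeNormedModType R) :=
  CompatibleSymplectic {
    ip : {dot H for idfun};
    omega : {skew_symmetric H};
    J : {linear H -> H};
    ip_norm : forall x, ip x x = `|x| ^+ 2;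
    omega_nondegenerate : forall x, (forall y, omega x y = 0) -> x = 0;
    J_orthogonal : forall x y, ip (J x) (J y) = ip x y;
    J_square : forall x, J (J x) = - x;
    omega_compatible : forall x y, omega x y = ip (J x) y
  }.

(* The complex Hilbert space H_J: an alias of [H] on which [R[i]] acts by
   (a + ib) x = a x + b (J x). *)
Definition complexified (R : realType) (H : completeNormedModType R)
  (S : compatible_symplectic H) : Type := H.

Section ComplexStructure.
Variables (R : realType) (H : completeNormedModType R).
Variable S : compatible_symplectic H.
Local Notation HJ := (complexified S).

HB.instance Definition _ := GRing.Zmodule.copy HJ H.

Definition cscale (z : R[i]) (x : HJ) : HJ :=
  let: a +i* b := z in (a *: (x : H) + b *: J S x : H).

Lemma cscaleA a b v : cscale a (cscale b v) = cscale (a * b) v.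
Proof.
case: a b => [a1 a2] [b1 b2]; rewrite /cscale /=.
rewrite (linearD (J S)) !(linearZ_LR (J S)) /= J_square.
rewrite !scalerDr !scalerA scalerN !scalerBl !scalerDl.
by rewrite [RHS]addrACA [X in _ + X = _]addrC.
Qed.

Lemma cscale1 : left_id 1 cscale.
Proof. by move=> v; rewrite /cscale /= scale1r scale0r addr0. Qed.

Lemma cscaleDr : right_distributive cscale +%R.
Proof.
move=> [a b] u v; rewrite /cscale (linearD (J S)) !scalerDr.
by rewrite addrACA.
Qed.

Lemma cscaleDl v : {morph cscale^~ v : a b / a + b}.
Proof. by move=> [a1 a2] [b1 b2]; rewrite /cscale /= !scalerDl addrACA. Qed.

HB.instance Definition _ :=
  GRing.Zmodule_isLmodule.Build R[i] HJ cscaleA cscale1 cscaleDr cscaleDl.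

Definition herm (x y : HJ) : R[i] := ip S x y -i* omega S x y.

Lemma herm_bilinear : bilinear_for
  (GRing.Scale.Law.clone _ _ *%R _)
  (GRing.Scale.Law.clone _ _ (@conjc R \; *%R) _) herm.
Proof.
have JE x y : ip S x (J S y) = - omega S x y.
  by rewrite omega_compatible -[LHS]J_orthogonal J_square linearNr.
split=> [u|u] [a b] x y; apply/eqP; rewrite eq_complex /herm /=;
  apply/andP; split; apply/eqP.
- rewrite 2!linearDl 2!linearZl_LR /= -omega_compatible; ring.
- rewrite 2!linearDl 2!linearZl_LR /= [omega S (J S x) u]omega_compatible.
  rewrite J_square linearNl; ring.
- rewrite 2!linearDr 2!linearZr_LR /= JE; ring.
- rewrite 2!linearDr 2!linearZr_LR /= [omega S u (J S x)]omega_compatible.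
  rewrite J_orthogonal; ring.
Qed.

HB.instance Definition _ :=
  bilinear_isBilinear.Build R[i] HJ HJ R[i] _ _ herm herm_bilinear.

Lemma herm_sym x y : herm x y = (-1) ^+ false * (herm y x)^*.
Proof.
rewrite expr0 mul1r /herm /=; congr (_ +i* _).
  by rewrite [LHS]hermC expr0 mul1r.
by rewrite [in LHS]hermC expr1 /= mulN1r.
Qed.

HB.instance Definition _ := isHermitianSesquilinear.Build
  R[i] HJ false (@conjc R) herm herm_sym.

Lemma herm_gt0 x : x != 0 -> 0 < herm x x.
Proof.
move=> x0; have o : omega S x x = 0.
  have/eqP := hermC (omega S) x x.
  by rewrite expr1 mulN1r -subr_eq0 opprK -mulr2n mulrn_eq0 /= => /eqP.
by rewrite /herm o ltcE /= oppr0 eqxx /= neq0_dnorm_gt0.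
Qed.

HB.instance Definition _ := isDotProduct.Build R[i] HJ herm herm_gt0.

Definition hnorm (x : HJ) : R := `|x : H|.

Definition bounded_op (A : HJ -> HJ) : Prop :=
  exists M : R, forall x, hnorm (A x) <= M * hnorm x.

Definition opnorm (A : HJ -> HJ) : R :=
  sup [set hnorm (A x) | x in [set x | hnorm x <= 1]].

Definition Ker (A : HJ -> HJ) : set HJ := [set x | A x = 0].

Definition lin_indep n (v : 'I_n -> HJ) : Prop :=
  forall c : 'I_n -> R[i], \sum_(i < n) c i *: v i = 0 -> forall i, c i = 0.

(* Complex dimension of a complex subspace, +oo in the infinite-dimensional
   case. *)
Definition cdim (V : set HJ) : \bar R :=
  ereal_sup [set n%:R%:E | n in
    [set n : nat | exists v : 'I_n -> HJ, (forall i, V (v i)) /\ lin_indep v]].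

Definition finite_codim (V : set HJ) : Prop :=
  exists (n : nat) (w : 'I_n -> HJ), forall y, exists2 x, V x &
    exists c : 'I_n -> R[i], y = x + \sum_(i < n) c i *: w i.

Definition fredholm (A : {linear HJ -> HJ}) : Prop :=
  [/\ bounded_op A, (cdim (Ker A) < +oo)%E,
      closed (range A : set H) & finite_codim (range A)].

Definition unitary (U : {linear HJ -> HJ}) : Prop :=
  (forall y, exists x, U x = y) /\ (forall x y, herm (U x) (U y) = herm x y).

Definition unitary_fredholm (U : {linear HJ -> HJ}) : Prop :=
  unitary U /\ fredholm (U \+ idfun).

Definition resolvent_set (A : {linear HJ -> HJ}) : set R[i] :=
  [set z | exists B : {linear HJ -> HJ},
    [/\ bounded_op B, cancel (A \- z \*: idfun) B
      & cancel B (A \- z \*: idfun)]].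

Definition spectrum (A : {linear HJ -> HJ}) : set R[i] := ~` resolvent_set A.

Definition expi (t : R) : R[i] := cos t +i* sin t.

Definition mult (U : {linear HJ -> HJ}) (theta : R) : \bar R :=
  cdim (Ker (U \- expi (pi + theta) \*: idfun)).

Definition finite_mult (U : {linear HJ -> HJ}) (e : R) : Prop :=
  (\esum_(theta in [set theta | (`|theta| <= e)%R]) mult U theta < +oo)%E.

(* The sum in [finite_mult] is meant to count, with multiplicity, the whole
   spectrum of [U] in the arc |theta| <= e around -1, which therefore has to
   consist of eigenvalues.  Finiteness of the sum of the dimensions of the
   kernels alone does not exclude continuous spectrum in the arc, and then
   [maslov_sum] does depend on the choices: on L^2([a, b]), 0 < a < b < pi, take
     d(t) = - exp (i (X + t c <., 1> 1)),
   X the multiplication by the variable and c > 0 small.  In the arc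
   |theta| < pi it has no eigenvalue for t = 0 and exactly one, with
   b < theta, for 0 < t <= 1.  With N = 1, an eps in (0, pi) beyond these
   eigenvalues gives 1, and any eps in (0, a) gives 0. *)
Definition point_arc (U : {linear HJ -> HJ}) (e : R) : Prop :=
  forall theta : R, `|theta| <= e -> spectrum U (expi (pi + theta)) ->
    exists2 x, x != 0 & U x = expi (pi + theta) *: x.

(* Only [t 0], ..., [t N] and [eps 1], ..., [eps N] are relevant. *)
Definition maslov_data (d : R -> {linear HJ -> HJ})
    (N : nat) (t eps : nat -> R) : Prop :=
  [/\ t 0%N = 0, t N = 1,
      forall j, (1 <= j <= N)%N -> t j.-1 < t j,
      forall j, (1 <= j <= N)%N -> 0 < eps j < pi
    & forall j, (1 <= j <= N)%N -> forall s, t j.-1 <= s <= t j ->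
        [/\ resolvent_set (d s) (expi (pi + eps j)),
            resolvent_set (d s) (expi (pi - eps j)),
            finite_mult (d s) (eps j)
          & point_arc (d s) (eps j)]].

Definition maslov_count (U : {linear HJ -> HJ}) (e : R) : \bar R :=
  \esum_(theta in [set theta | (0 <= theta <= e)%R]) mult U theta.

Definition maslov_sum (d : R -> {linear HJ -> HJ})
    (N : nat) (t eps : nat -> R) : \bar R :=
  (\sum_(1 <= j < N.+1)
     (maslov_count (d (t j)) (eps j) - maslov_count (d (t j.-1)) (eps j)))%E.

Definition norm_continuous_path (d : R -> {linear HJ -> HJ}) : Prop :=
  forall t, `[0, 1]%classic t ->
    opnorm (d s \- d t) @[s --> within `[0, 1]%classic (nbhs t)] --> (0 : R).

End ComplexStructure.

(* Main.v *)
(* On an interval of the common refinement of the two partitions both radii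
   e < e' are admissible, and the counts for e' and e differ by the number of
   eigenvalues with angle in ]e, e'[; it has to be shown that this number is
   locally constant. Put the midpoint of the arc at 1 by a rotation W of d(t).
   With c the cosine of half the length of the arc, Re <W x, x> exceeds c |x|^2
   by a gap on the span E of the eigenvectors of the arc, and falls below it by
   a gap on the orthogonal complement of E: otherwise the top of the spectrum of
   the self-adjoint part of W there would be isolated, and an isolated point at
   the end of the spectrum is an eigenvalue. If two such operators are close, a
   vector in one space E orthogonal to the other one contradicts these
   inequalities, so that the two spaces have the same dimension. *)
Require Import Defs.
From HB Require Import structures.
From mathcomp Require Import all_boot all_order all_algebra.
From mathcomp Require Import all_classical all_reals all_analysis.
From mathcomp Require Import complex ring lra.

Set Implicit Arguments.
Unset Strict Implicit.
Unset Printing Implicit Defensive.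

Import Order.TTheory GRing.Theory Num.Theory.
Import numFieldNormedType.Exports.

Local Open Scope classical_set_scope.
Local Open Scope complex_scope.
Local Open Scope ring_scope.

(** * Symmetric operators on an invariant subspace of a real Hilbert space *)

Section RealHilbert.
Variables (R : realType) (H : completeNormedModType R).
Variable dot : {dot H for idfun}.
Hypothesis dot_norm : forall x, dot x x = `|x| ^+ 2.

Let dotDl x y z : dot (x + y) z = dot x z + dot y z.
Proof. exact: linearDl. Qed.
Let dotBl x y z : dot (x - y) z = dot x z - dot y z.
Proof. exact: linearBl. Qed.
Let dotZl a x z : dot (a *: x) z = a * dot x z.
Proof. exact: linearZl_LR. Qed.
Let dotDr x y z : dot z (x + y) = dot z x + dot z y.
Proof. exact: linearDr. Qed.
Let dotBr x y z : dot z (x - y) = dot z x - dot z y.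
Proof. exact: linearBr. Qed.
Let dotZr a x z : dot z (a *: x) = a * dot z x.
Proof. exact: linearZr_LR. Qed.
Let dotE := (dotBl, dotBr, dotZl, dotZr, dotDl, dotDr).

Definition linear_subspace (K : set H) :=
  K 0 /\ forall (a : R) x y, K x -> K y -> K (a *: x + y).

Lemma linear_subspaceZ K a x : linear_subspace K -> K x -> K (a *: x).
Proof. by move=> [K0 KD] Kx; rewrite -[_ *: _]addr0; exact: KD. Qed.

Lemma linear_subspaceB K x y : linear_subspace K -> K x -> K y -> K (x - y).
Proof. by move=> [K0 KD] Kx Ky; rewrite addrC -scaleN1r; exact: KD. Qed.

Definition symmetric_op (T : H -> H) := forall x y, dot (T x) y = dot x (T y).

Definition bounded_below (K : set H) (T : H -> H) :=
  exists2 k : R, 0 < k & forall x, K x -> k * `|x| <= `|T x|.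

Section Invariant.
Variables (K : set H) (T : {linear H -> H}).
Hypotheses (Ksub : linear_subspace K) (TK : forall x, K x -> K (T x)).
Hypothesis Tsym : symmetric_op T.

(** Nonnegativity of the form at [x - L^-1 *: T x], together with its upper bound at [T x], gives
    [0 <= <T x, x> - |T x|^2 / L]. *)
Lemma psd_norm_sq_le (L : R) : 0 < L ->
  (forall x, K x -> 0 <= dot (T x) x <= L * `|x| ^+ 2) ->
  forall x, K x -> `|T x| ^+ 2 <= L * dot (T x) x.
Proof.
move=> L0 hT x Kx; have Ky : K (x - L^-1 *: T x).
  by apply: linear_subspaceB => //; apply: linear_subspaceZ => //; exact: TK.
have /andP[+ _] := hT _ Ky; have /andP[_] := hT _ (TK Kx).
rewrite (linearB T) (linearZ_LR T) /= !dotE (Tsym (T x) x) -!dot_norm.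
set a := dot (T (T x)) _; set b := dot (T x) (T x); set c := dot _ x => h1 h2.
have Li : L * L^-1 = 1 by rewrite divff// gt_eqF.
have h3 : 0 <= L ^+ 2 * (c - L^-1 * b - L^-1 * (b - L^-1 * a)).
  by rewrite mulr_ge0 ?sqr_ge0//; move: h2; lra.
have h4 : 0 <= L ^+ 2 * c - (L * L^-1) * (L * b) - (L * L^-1) * (L * b)
    + (L * L^-1) ^+ 2 * a by move: h3; rewrite le_eqVlt => /orP[/eqP h3|h3]; lra.
rewrite Li !mul1r expr1n mul1r in h4.
have : 0 <= L * (L * c - b) by lra.
by rewrite pmulr_rge0// subr_ge0.
Qed.

End Invariant.

Section RayleighInfimum.
Variables (K : set H) (T : {linear H -> H}).
Hypotheses (Ksub : linear_subspace K) (TK : forall x, K x -> K (T x)).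
Hypothesis Tsym : symmetric_op T.

(* The infimum m of the Rayleigh quotients of T on K satisfies
   |(T - m) x|^2 <= L <(T - m) x, x>, so T - m is not bounded below. *)
Lemma psd_of_bounded_below (l L : R) :
  (forall x, K x -> - l * `|x| ^+ 2 <= dot (T x) x <= L * `|x| ^+ 2) ->
  (forall m : R, - l <= m < 0 -> bounded_below K (fun x => T x - m *: x)) ->
  forall x, K x -> 0 <= dot (T x) x.
Proof.
move=> hT hB x0 Kx0; rewrite leNgt; apply/negP => x0lt.
have x0n : 0 < `|x0| ^+ 2.
  by rewrite exprn_gt0// normr_gt0; apply: contraTneq x0lt => ->;
     rewrite linear0r ltxx.
pose P := [set m : R | forall x, K x -> m * `|x| ^+ 2 <= dot (T x) x].
have Pl : P (- l) by move=> x /hT /andP[].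
have Pub m : P m -> m <= dot (T x0) x0 / `|x0| ^+ 2.
  by move=> /(_ _ Kx0); rewrite ler_pdivlMr.
have Psup : has_sup P.
  by split; [exists (- l)|exists (dot (T x0) x0 / `|x0| ^+ 2) => m /Pub].
set m := sup P.
have lm : - l <= m by apply: sup_ubound => //; case: Psup.
have m0 : m < 0.
  apply: le_lt_trans (_ : dot (T x0) x0 / `|x0| ^+ 2 < 0).
    by apply: ge_sup; [exists (- l)|move=> ? /Pub].
  by rewrite pmulr_llt0// invr_gt0.
have Pm : P m.
  move=> x Kx; have [->|x_neq0] := eqVneq x 0.
    by rewrite normr0 expr0n mulr0 linear0r.
  rewrite -ler_pdivlMr; last by rewrite exprn_gt0// normr_gt0.
  apply: ge_sup; first by exists (- l).
  by move=> u /(_ _ Kx); rewrite ler_pdivlMr// exprn_gt0// normr_gt0.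
have [|k k0 hk] := hB m; first by rewrite lm.
pose C : {linear H -> H} := T \- m \*: idfun.
have CE x : dot (C x) x = dot (T x) x - m * `|x| ^+ 2.
  by rewrite /C /= dotBl dotZl dot_norm.
(* No sign is given for [l] or [L]: the two bounds at the nonzero vector [x0] force [- l <= L], so
   the sum is positive. *)
have L0 : 0 < `|L| + l + 1.
  have : 0 <= (`|L| + l) * `|x0| ^+ 2.
    have /andP[h1 h2] := hT _ Kx0; have := le_trans h1 h2.
    rewrite mulrDl; have : L * `|x0| ^+ 2 <= `|L| * `|x0| ^+ 2.
      by rewrite ler_pM2r// ler_norm.
    lra.
  by rewrite pmulr_lge0//; lra.
have Csym : symmetric_op C.
  by move=> x y; rewrite /C /= !dotE Tsym.
have CK x : K x -> K (C x).
  by move=> Kx; apply: linear_subspaceB => //; [exact: TK|exact: linear_subspaceZ].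
have Cb x : K x -> 0 <= dot (C x) x <= (`|L| + l + 1) * `|x| ^+ 2.
  move=> Kx; rewrite CE subr_ge0 Pm//=.
  have /andP[_ h] := hT _ Kx; have x2 := sqr_ge0 `|x|.
  have : L * `|x| ^+ 2 <= `|L| * `|x| ^+ 2 by rewrite ler_wpM2r// ler_norm.
  have : 0 <= (m + l) * `|x| ^+ 2 by rewrite mulr_ge0//; lra.
  nra.
have Cl := psd_norm_sq_le Ksub CK Csym L0 Cb.
(* [k^2 |x|^2 <= |C x|^2 <= (|L| + l + 1) <C x, x>] on [K] makes this a lower bound of the Rayleigh
   quotients that exceeds the supremum [m]. *)
have : P (m + k ^+ 2 / (`|L| + l + 1)).
  move=> x Kx; rewrite mulrDl -lerBrDl -CE mulrAC ler_pdivrMr// [leRHS]mulrC.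
  apply: le_trans (Cl x Kx).
  rewrite -exprMn ler_pXn2r ?nnegrE//; last by rewrite mulr_ge0// ltW.
  exact: (hk x Kx).
move=> /(ub_le_sup (proj2 Psup)); rewrite -/m gerDl leNgt divr_gt0// exprn_gt0//.
Qed.

End RayleighInfimum.

Section SpectralGap.
Variables (K : set H) (T : {linear H -> H}).
Hypotheses (Ksub : linear_subspace K) (TK : forall x, K x -> K (T x)).
Hypothesis Tsym : symmetric_op T.
Variable L : R.
Hypothesis T_psd : forall x, K x -> 0 <= dot (T x) x <= L * `|x| ^+ 2.

(* For - r^2 / 4 <= m < 0, T^2 - r T - m = (T - a) (T - b) with a, b in ]0, r[. *)
Lemma gap_norm_sq_ge (r : R) : 0 < r ->
  (forall a, 0 < a < r -> bounded_below K (fun x => T x - a *: x)) ->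
  forall x, K x -> r * dot (T x) x <= `|T x| ^+ 2.
Proof.
move=> r0 hr x Kx; pose B : {linear H -> H} := T \o T \- r \*: T.
have BE y : dot (B y) y = `|T y| ^+ 2 - r * dot (T y) y.
  by rewrite /B /= dotBl dotZl Tsym dot_norm.
rewrite -subr_ge0 -BE.
have L1 : 0 < `|L| + 1 by rewrite ltr_wpDl.
have T_psd' y : K y -> 0 <= dot (T y) y <= (`|L| + 1) * `|y| ^+ 2.
  move=> Ky; have /andP[-> /le_trans->//] := T_psd Ky.
  by rewrite ler_wpM2r ?sqr_ge0// ler_wpDr// ler_norm.
apply: (@psd_of_bounded_below K B Ksub _ _ (r ^+ 2 / 4) ((`|L| + 1) ^+ 2)) => //.
- by move=> y Ky; apply: linear_subspaceB => //; [do 2 apply: TK|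
    apply: linear_subspaceZ => //; exact: TK].
- by move=> y z; rewrite /B /= !dotE !Tsym.
- move=> y Ky; rewrite BE; apply/andP; split.
    (* Completing the square, [T^2 - r T = (T - r / 2)^2 - r^2 / 4], gives the lower bound. *)
    have : 0 <= `|T y - (r / 2) *: y| ^+ 2 by rewrite sqr_ge0.
    rewrite -dot_norm !dotE !dot_norm -Tsym.
    lra.
  have h1 := psd_norm_sq_le Ksub TK Tsym L1 T_psd' Ky.
  have /andP[h2 h3] := T_psd' _ Ky.
  have h4 : (`|L| + 1) * dot (T y) y <= (`|L| + 1) * ((`|L| + 1) * `|y| ^+ 2).
    by rewrite ler_pM2l.
  have h5 : 0 <= r * dot (T y) y by rewrite mulr_ge0// ltW.
  lra.
(* The roots are [r / 2 + s] and [r / 2 - s]; below, [a] and [b] are the constants bounding the two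
   factors from below, and they multiply. *)
move=> m /andP[lm m0]; pose s := Num.sqrt (r ^+ 2 / 4 + m).
have sE : s ^+ 2 = r ^+ 2 / 4 + m by rewrite sqr_sqrtr//; lra.
have s0 : 0 <= s by exact: sqrtr_ge0.
have sr : s < r / 2.
  by rewrite -(@ltr_pXn2r _ 2) ?nnegrE//; [rewrite sE expr_div_n; lra|lra].
have [|a a0 ha] := hr (r / 2 + s); first lra.
have [|b b0 hb] := hr (r / 2 - s); first lra.
exists (a * b); first by rewrite mulr_gt0.
move=> y Ky; rewrite -mulrA.
set u := T y - (r / 2 - s) *: y.
have Ku : K u by apply: linear_subspaceB => //; [exact: TK|exact: linear_subspaceZ].
apply: (@le_trans _ _ (a * `|u|)); first by rewrite ler_pM2l//; exact: hb.
apply: le_trans (ha _ Ku) _; rewrite le_eqVlt; apply/orP; left; apply/eqP.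
congr (`| _ |); rewrite /u /B /= (linearB T) (linearZ_LR T) /=.
rewrite scalerBr scalerA.
rewrite (_ : (r / 2 + s) * (r / 2 - s) = - m); last first.
  have : s * s = r ^+ 2 / 4 + m by rewrite -sE.
  lra.
rewrite scaleNr opprK opprD !addrA; congr (_ - _).
rewrite -addrA -opprD -scalerDl; congr (_ - _ *: _); lra.
Qed.

(** The gap makes [f = 1 - T / L'] shrink the form [<T x, x>] by a factor below 1, so that the
    iterates of [f] converge geometrically, to a vector of the kernel. A start with small Rayleigh
    quotient moves too little in total to end at 0. *)
Lemma gap_kernel (r : R) : 0 < r ->
  closed K ->
  (forall x, K x -> r * dot (T x) x <= `|T x| ^+ 2) ->
  (forall e : R, 0 < e ->
    exists x, [/\ K x, x != 0 & dot (T x) x <= e * `|x| ^+ 2]) ->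
  exists y, [/\ K y, y != 0 & T y = 0].
Proof.
move=> r0 Kcl gap small.
(* [L' > r] keeps [1 - r / L'] positive, as needed for its square root [rho]. *)
have [L' [L'0 rL T_psd']] : exists L', [/\ 0 < L', r < L' &
    forall x, K x -> 0 <= dot (T x) x <= L' * `|x| ^+ 2].
  exists (`|L| + r + 1); split; [|have := normr_ge0 L; lra|].
    by have := normr_ge0 L; lra.
  move=> y Ky; have /andP[-> /le_trans->//] := T_psd Ky.
  by rewrite ler_wpM2r ?sqr_ge0//; have := ler_norm L; lra.
have nsq := psd_norm_sq_le Ksub TK Tsym L'0 T_psd'.
pose rho := Num.sqrt (1 - r / L').
have rL1 : r / L' < 1 by rewrite ltr_pdivrMr// mul1r.
have rL0 : 0 < r / L' by rewrite divr_gt0.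
have rho2 : rho ^+ 2 = 1 - r / L' by rewrite sqr_sqrtr//; lra.
have rho0 : 0 <= rho by exact: sqrtr_ge0.
have rho1 : rho < 1 by rewrite -(@ltr_pXn2r _ 2) ?nnegrE// rho2 expr1n; lra.
(* With this constant the [n]-th step has norm at most [(1 - rho) / 2 * |x| * rho^n], and all steps
   together at most [|x| / 2]. *)
have [|x [Kx x0 xs]] := small (L' * ((1 - rho) / 2) ^+ 2).
  by rewrite mulr_gt0// exprn_gt0//; lra.
pose q y := dot (T y) y.
pose f y := y - L'^-1 *: T y.
have fK y : K y -> K (f y).
  by move=> Ky; apply: linear_subspaceB => //; apply: linear_subspaceZ => //; exact: TK.
have Li : L' * L'^-1 = 1 by rewrite divff// gt_eqF.
have qf y : K y -> q (f y) <= rho ^+ 2 * q y.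
  move=> Ky; have h1 := gap _ Ky.
  have /andP[_ h2] := T_psd' _ (TK Ky).
  rewrite /q /f (linearB T) (linearZ_LR T) /= !dotE (Tsym (T y) y) !dot_norm rho2.
  move: h1 h2; rewrite -/(q y); set a := dot (T (T y)) _; set b := _ ^+ 2.
  move=> h1 h2.
  have : L'^-1 * (r * q y) <= L'^-1 * b by rewrite ler_pM2l ?invr_gt0.
  have : L'^-1 * (L'^-1 * a) <= L'^-1 * (L'^-1 * (L' * b)).
    by rewrite !ler_pM2l ?invr_gt0.
  rewrite (mulrA L'^-1 L' b) (mulrC _ L') Li mul1r; lra.
pose u n := iter n f x.
have uK n : K (u n) by elim: n => // n IH; exact: fK.
have qu n : q (u n) <= rho ^+ n ^+ 2 * q x.
  elim: n => [|n IH]; first by rewrite expr0 expr1n mul1r.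
  apply: le_trans (qf _ (uK n)) _.
  have -> : rho ^+ n.+1 ^+ 2 * q x = rho ^+ 2 * (rho ^+ n ^+ 2 * q x).
    by rewrite (exprS _ n) exprMn mulrA.
  by apply: ler_wpM2l => //; exact: sqr_ge0.
pose c := (1 - rho) / 2 * `|x|.
have c0 : 0 <= c by rewrite mulr_ge0//; lra.
have Tu n : `|T (u n)| <= L' * (c * rho ^+ n).
  rewrite -(@ler_pXn2r _ 2) ?nnegrE//; last first.
    by rewrite mulr_ge0 ?(ltW L'0)// mulr_ge0// exprn_ge0.
  apply: le_trans (nsq _ (uK n)) _.
  rewrite exprMn [L' ^+ 2]expr2 -mulrA ler_pM2l//.
  apply: le_trans (qu n) _.
  have -> : L' * (c * rho ^+ n) ^+ 2 =
      rho ^+ n ^+ 2 * (L' * ((1 - rho) / 2) ^+ 2 * `|x| ^+ 2).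
    by rewrite /c; ring.
  by apply: ler_wpM2l => //; exact: sqr_ge0.
pose w n := u n.+1 - u n.
have wE n : `|w n| <= geometric c rho n.
  have -> : w n = - (L'^-1 *: T (u n)) by rewrite /w /= /f addrAC subrr add0r.
  rewrite normrN normrZ (@ger0_norm _ L'^-1) ?invr_ge0 ?(ltW L'0)//= ler_pdivrMl//.
have rhon : `|rho| < 1 by rewrite ger0_norm.
have cvgN : cvgn [normed series w].
  apply: (series_le_cvg _ _ wE) => [n|n|]; first exact: normr_ge0.
    by rewrite /= mulr_ge0// exprn_ge0.
  exact: is_cvg_geometric_series.
have cvgw := normed_cvg cvgN.
have uE : u = (fun n => x + series w n).
  apply/funext => n; rewrite /series /= telescope_sumr//.
  by rewrite addrC subrK.
pose y := x + limn (series w).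
have uy : u @ \oo --> y by rewrite uE; apply: cvgD => //; exact: cvg_cst.
have Ky : K y.
  by apply: (@closed_cvg _ _ \oo _ u K Kcl _ y uy); exact: nearW.
exists y; split => //.
  (* A zero limit would be a total displacement of norm [|x|], against the bound [|x| / 2]. *)
  apply: contraTneq (x0) => y0; rewrite negbK -normr_le0.
  have : `|limn (series w)| <= c / (1 - rho).
    apply: le_trans (lim_series_norm cvgN) _.
    rewrite -(cvg_lim _ (cvg_geometric_series rhon))//.
    apply: lim_series_le => //; exact: is_cvg_geometric_series.
  have -> : limn (series w) = - x by apply/eqP; rewrite -subr_eq0 opprK addrC -y0.
  have -> : c / (1 - rho) = `|x| / 2 by rewrite /c; field; lra.
  by rewrite normrN; lra.
have Tlip z : K z -> `|T z| <= L' * `|z|.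
  move=> Kz; rewrite -(@ler_pXn2r _ 2) ?nnegrE//; last by rewrite mulr_ge0// ltW.
  apply: le_trans (nsq _ Kz) _; rewrite exprMn expr2 -mulrA ler_pM2l//.
  by have /andP[] := T_psd' _ Kz.
(* [|T y| <= L' |y - u n| + |T (u n)|], and both terms tend to 0. *)
have : `|T y| <= 0.
  have h1 : (L' * `|y - u n| + L' * (c * rho ^+ n)) @[n --> \oo]
      --> L' * `|y - y| + L' * (c * 0).
    apply: cvgD; apply: cvgMl_tmp.
      apply: cvg_norm; apply: cvgB => //; exact: cvg_cst.
    by apply: cvgMl_tmp; exact: cvg_expr.
  rewrite subrr normr0 !mulr0 addr0 in h1.
  apply: (cvgr_to_ge h1); apply: nearW => n.
  rewrite -[y in T y](subrK (u n)) (linearD T) (le_trans (ler_normD _ _))//.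
  by rewrite lerD// Tlip//; exact: linear_subspaceB.
by rewrite normr_le0 => /eqP.
Qed.

End SpectralGap.
End RealHilbert.

(** * The top of the spectrum of a symmetric operator *)

Section TopGap.
Variables (R : realType) (H : completeNormedModType R).
Variable dot : {dot H for idfun}.
Hypothesis dot_norm : forall x, dot x x = `|x| ^+ 2.

Lemma gap_below_seq (s : seq R) (M : R) :
  exists2 r, 0 < r & forall mu, mu \in s -> mu < M -> mu <= M - r.
Proof.
elim: s => [|a s [r r0 hr]]; first by exists 1.
have [aM|Ma] := ltP a M.
  exists (Num.min r (M - a)); first by rewrite lt_min r0 subr_gt0.
  move=> mu; rewrite inE => /orP[/eqP -> _|/hr h /h mur].
    by rewrite lerBrDr -lerBrDl ge_min lexx orbT.
  by apply: le_trans mur _; rewrite lerB// ge_min lexx.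
exists r => // mu; rewrite inE => /orP[/eqP ->|/hr//].
by rewrite ltNge Ma.
Qed.

(** [s] lists the exceptional values, at which [A - mu] need not be bounded below. Suppose the
    supremum [M] of the Rayleigh quotients were at least [c]. If [M] is outside [s], the lower bound
    for [A - M] contradicts extremality; if [M] is in [s], there is a gap just below it and
    [gap_kernel] produces an eigenvector. *)
Lemma rayleigh_lt_of_no_eigenvector (K : set H) (A : {linear H -> H})
    (c b : R) (s : seq R) :
  linear_subspace K -> closed K -> (forall x, K x -> K (A x)) ->
  symmetric_op dot A ->
  (forall x, K x -> - b * `|x| ^+ 2 <= dot (A x) x <= b * `|x| ^+ 2) ->
  c \notin s ->
  (forall mu, c <= mu <= b -> mu \notin s ->
    bounded_below K (fun x => A x - mu *: x)) ->
  (forall mu x, c <= mu <= b -> K x -> A x = mu *: x -> x = 0) ->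
  exists2 d, 0 < d & forall x, K x -> dot (A x) x <= (c - d) * `|x| ^+ 2.
Proof.
move=> Ksub Kcl AK Asym Ab cs bb noeig.
pose P := [set m : R | forall x, K x -> dot (A x) x <= m * `|x| ^+ 2].
have Pb : P b by move=> x /Ab /andP[].
(* An upper bound below [c] settles the claim; this case includes [K] reduced to 0. *)
have [[m [Pm mc]]|Pge] := pselect (exists m, P m /\ m < c).
  by exists (c - m); [rewrite subr_gt0|rewrite opprB addrC subrK].
have Plb : lbound P c.
  by move=> m Pm; rewrite leNgt; apply/negP => mc; apply: Pge; exists m.
have Pinf : has_inf P by split; [exists b|exists c].
set M := inf P.
have cM : c <= M by apply: lb_le_inf; first by exists b.
have Mb : M <= b by apply: (ge_inf (proj2 Pinf)).
have PM : P M.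
  move=> x Kx; have [->|x_neq0] := eqVneq x 0.
    by rewrite normr0 expr0n mulr0 linear0r.
  have x2 : 0 < `|x| ^+ 2 by rewrite exprn_gt0// normr_gt0.
  rewrite -ler_pdivrMr//; apply: lb_le_inf; first by exists b.
  by move=> u /(_ _ Kx); rewrite ler_pdivrMr.
pose T : {linear H -> H} := M \*: idfun \- A.
have TE x : dot (T x) x = M * `|x| ^+ 2 - dot (A x) x.
  rewrite /T /= -dot_norm (linearBl dot x (M *: x) (A x)).
  by rewrite (linearZl_LR dot x M x).
have small e : 0 < e -> exists x, [/\ K x, x != 0 & dot (T x) x <= e * `|x| ^+ 2].
  move=> e0; apply: contrapT => h.
  have : P (M - e).
    move=> x Kx; have [->|x_neq0] := eqVneq x 0.
      by rewrite normr0 expr0n mulr0 linear0r.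
    rewrite leNgt; apply/negP => hx; apply: h; exists x; split => //.
    by rewrite TE; lra.
  move=> /(ge_inf (proj2 Pinf)); rewrite -/M; lra.
have TK x : K x -> K (T x).
  move=> Kx; rewrite /T /=.
  exact: (linear_subspaceB Ksub (linear_subspaceZ M Ksub Kx) (AK _ Kx)).
have Tsym : symmetric_op dot T.
  move=> x y; rewrite /T /=.
  have -> : dot (M *: x - A x) y = M * dot x y - dot (A x) y.
    by rewrite linearBl linearZl_LR.
  have -> : dot x (M *: y - A y) = M * dot x y - dot x (A y).
    by rewrite linearBr linearZr_LR.
  by rewrite Asym.
pose L := `|M| + `|b| + 1.
have L0 : 0 < L by rewrite ltr_wpDl// addr_ge0.
have T_psd x : K x -> 0 <= dot (T x) x <= L * `|x| ^+ 2.
  move=> Kx; rewrite TE subr_ge0 PM//=.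
  have /andP[h1 _] := Ab _ Kx; have h2 := sqr_ge0 `|x|.
  have h3 : M * `|x| ^+ 2 <= `|M| * `|x| ^+ 2 by rewrite ler_wpM2r// ler_norm.
  have h4 : b * `|x| ^+ 2 <= `|b| * `|x| ^+ 2 by rewrite ler_wpM2r// ler_norm.
  by rewrite /L; lra.
have TbbE a : bounded_below K (fun x => A x - (M - a) *: x) ->
    bounded_below K (fun x => T x - a *: x).
  move=> [k k0 hk]; exists k => // x Kx; apply: le_trans (hk _ Kx) _.
  rewrite -(normrN (T x - _)) scalerBl /T /= !opprB.
  by rewrite addrCA.
(* Outside [s], a nonzero vector with quotient at most [k^2 / (2 L)] violates
   [k^2 |x|^2 <= |T x|^2 <= L <T x, x>]. *)
have [Ms|Ms] := boolP (M \in s); last first.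
  have [|k k0 hk] := bb M _ Ms; first by rewrite cM.
  have [|x [Kx x0 xs]] := small (k ^+ 2 / (2 * L)).
    by rewrite divr_gt0 ?exprn_gt0// mulr_gt0.
  have x2 : 0 < `|x| ^+ 2 by rewrite exprn_gt0// normr_gt0.
  have h1 : `|T x| ^+ 2 <= L * dot (T x) x.
    exact: (psd_norm_sq_le dot_norm Ksub TK Tsym L0 T_psd Kx).
  have h2 : L * dot (T x) x <= L * (k ^+ 2 / (2 * L) * `|x| ^+ 2) by rewrite ler_pM2l.
  have h3 : (k * `|x|) ^+ 2 <= `|T x| ^+ 2.
    rewrite ler_pXn2r ?nnegrE//; last by rewrite mulr_ge0// ltW.
    by rewrite -(normrN (T x)) /T /= opprB; exact: hk.
  have h4 : L * (k ^+ 2 / (2 * L) * `|x| ^+ 2) = (k * `|x|) ^+ 2 / 2.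
    by field; rewrite gt_eqF.
  have h5 : 0 < (k * `|x|) ^+ 2 by rewrite exprMn mulr_gt0// exprn_gt0.
  exfalso; lra.
(* As [c] is not in [s], [M] lies strictly above [c], which leaves room for a gap []M - r, M[]
   inside [[c, b]] that avoids [s]. *)
have cltM : c < M by rewrite lt_neqAle cM andbT; apply: contraNneq cs => ->.
have [r1 r10 hr1] := gap_below_seq s M.
pose r := Num.min r1 (M - c).
have r0 : 0 < r by rewrite lt_min r10 subr_gt0.
have rr1 : r <= r1 by rewrite ge_min lexx.
have rc : r <= M - c by rewrite ge_min lexx orbT.
have Tbb a : 0 < a < r -> bounded_below K (fun x => T x - a *: x).
  move=> /andP[a0 ar]; apply: TbbE; apply: bb.
    by apply/andP; split; lra.
  by apply/negP => /hr1 h; have := h ltac:(lra); lra.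
have gap := gap_norm_sq_ge dot_norm Ksub TK Tsym T_psd r0 Tbb.
have [y [Ky y0 Ty]] := gap_kernel dot_norm Ksub TK Tsym T_psd r0 Kcl gap small.
exfalso; move: y0; rewrite (noeig M y _ Ky) ?eqxx//; first by rewrite cM.
by apply/esym/eqP; rewrite -subr_eq0; apply/eqP.
Qed.

End TopGap.

(** * Points of the unit circle *)

Section Expi.
Variable R : realType.
Implicit Types a b : R.

Lemma expiD a b : expi (a + b) = expi a * expi b.
Proof.
rewrite /expi cosD sinD; apply/eqP.
by rewrite eq_complex /= addrC eqxx [_ + _ * _]addrC eqxx.
Qed.

Lemma expi0 : expi (0 : R) = 1.
Proof. by rewrite /expi cos0 sin0. Qed.

Lemma expiNK a : expi (- a) * expi a = 1.
Proof. by rewrite -expiD addNr expi0. Qed.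

Lemma expiKN a : expi a * expi (- a) = 1.
Proof. by rewrite -expiD subrr expi0. Qed.

Lemma conj_expi a : conjc (expi a) = expi (- a).
Proof. by rewrite /expi cosN sinN. Qed.

Lemma expiDN a : expi a + expi (- a) = ((cos a) *+ 2)%:C.
Proof. by rewrite /expi cosN sinN; apply/eqP; rewrite eq_complex /= mulr2n eqxx subrr eqxx. Qed.

(** The half-angle formula gives [sin ((a - b) / 2) = 0], and the sine has no zero in []0, pi[]. *)
Lemma expi_inj a b : `|a - b| < pi *+ 2 -> expi a = expi b -> a = b.
Proof.
move=> ab eab; have [] : cos (a - b) = 1 /\ sin (a - b) = 0.
  have : expi (a - b) = 1 by rewrite expiD eab expiKN.
  by rewrite /expi => -[].
move=> cab _; have : sin ((a - b) / 2) ^+ 2 = 0.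
  have : cos (a - b) = 1 - sin ((a - b) / 2) ^+ 2 *+ 2.
    have -> : a - b = ((a - b) / 2) *+ 2 by rewrite mulr2n; lra.
    rewrite cos_mulr2n; have := cos2Dsin2 ((a - b) / 2 *+ 2 / 2).
    have -> : (a - b) / 2 *+ 2 / 2 = (a - b) / 2 by rewrite mulr2n; lra.
    by rewrite !mulr2n; lra.
  rewrite cab; lra.
move/eqP; rewrite sqrf_eq0 => /eqP s0; apply/eqP; rewrite -subr_eq0.
case: (ltgtP (a - b) 0) => // h; exfalso.
  have := @sin_gt0_pi _ (- ((a - b) / 2)); rewrite sinN s0 oppr0 ltxx.
  have := ler_norm (- (a - b)); rewrite normrN => ?.
  by move=> /(_ _) f; apply/notF/f; apply/andP; split; lra.
have := @sin_gt0_pi _ ((a - b) / 2); rewrite s0 ltxx.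
have := ler_norm (a - b) => ?.
by move=> /(_ _) f; apply/notF/f; apply/andP; split; lra.
Qed.

End Expi.

(** * Hermitian geometry, unitary operators and linear independence *)

Section Unitary.
Variables (R : realType) (H : completeNormedModType R).
Variable S : compatible_symplectic H.
Local Notation HJ := (complexified S).
Implicit Types (x y : HJ) (U : {linear HJ -> HJ}).

Lemma hermDl x y (z : HJ) : herm (x + y) z = herm x z + herm y z.
Proof. exact: linearDl. Qed.
Lemma hermBl x y (z : HJ) : herm (x - y) z = herm x z - herm y z.
Proof. exact: linearBl. Qed.
Lemma hermZl a x (z : HJ) : herm (a *: x) z = a * herm x z.
Proof. exact: linearZl_LR. Qed.
Lemma hermZr a x (z : HJ) : herm z (a *: x) = conjc a * herm z x.
Proof. exact: linearZr_LR. Qed.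
Lemma herm_suml I (r : seq I) (P : pred I) (F : I -> HJ) (z : HJ) :
  herm (\sum_(i <- r | P i) F i) z = \sum_(i <- r | P i) herm (F i) z.
Proof. exact: linear_sumlz. Qed.
Lemma herm_sumr I (r : seq I) (P : pred I) (F : I -> HJ) (z : HJ) :
  herm z (\sum_(i <- r | P i) F i) = \sum_(i <- r | P i) herm z (F i).
Proof. exact: linear_sumr. Qed.
Lemma herm0l (z : HJ) : herm (0 : HJ) z = 0. Proof. exact: linear0l. Qed.

Lemma herm_conj x y : herm x y = conjc (herm y x).
Proof. by rewrite {1}herm_sym expr0 mul1r. Qed.

Lemma Re_herm x y : complex.Re (herm x y) = ip S x y. Proof. by []. Qed.

Lemma omegaxx x : omega S x x = 0.
Proof.
have /eqP := hermC (omega S) x x.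
by rewrite expr1 mulN1r -subr_eq0 opprK -mulr2n mulrn_eq0 /= => /eqP.
Qed.

Lemma hermxx x : herm x x = (hnorm x ^+ 2)%:C.
Proof. by rewrite /herm omegaxx ip_norm oppr0. Qed.

Lemma hnorm_ge0 x : 0 <= hnorm x. Proof. exact: normr_ge0. Qed.

Lemma hnorm_gt0 x : x != 0 -> 0 < hnorm x.
Proof. by rewrite /hnorm normr_gt0. Qed.

Lemma hnorm_eq x y : herm x x = herm y y -> hnorm x = hnorm y.
Proof.
rewrite !hermxx => -[] /eqP.
by rewrite eqrXn2 ?hnorm_ge0// => /eqP.
Qed.

Lemma hnorm_expi a x : hnorm (expi a *: x) = hnorm x.
Proof.
by apply: hnorm_eq; rewrite hermZl hermZr mulrA conj_expi expiKN mul1r.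
Qed.

Lemma hnormZ (a : R) x : 0 <= a -> hnorm (a%:C *: x) = a * hnorm x.
Proof.
move=> a0; rewrite /hnorm.
have -> : (a%:C *: x : H) = (a *: (x : H) + 0 *: J S x : H) by [].
by rewrite scale0r addr0 normrZ ger0_norm.
Qed.

(** Cauchy-Schwarz, from the squared norm of [|y| x - |x| y]. *)
Lemma ip_le_hnorm x y : ip S x y <= hnorm x * hnorm y.
Proof.
have [->|x0] := eqVneq x 0; first by rewrite linear0l /hnorm normr0 mul0r.
have [->|y0] := eqVneq y 0; first by rewrite linear0r /hnorm normr0 mulr0.
have hx := hnorm_gt0 x0; have hy := hnorm_gt0 y0.
have : 0 <= ip S (hnorm y *: (x : H) - hnorm x *: (y : H))
                 (hnorm y *: (x : H) - hnorm x *: (y : H)).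
  by rewrite ip_norm sqr_ge0.
rewrite linearBl !linearBr !linearZl_LR !linearZr_LR /= !ip_norm.
rewrite -/(hnorm x) -/(hnorm y) (hermC (ip S) y x) expr0 mul1r.
set p := ip S x y => h.
have : 0 <= (hnorm x * hnorm y) * (hnorm x * hnorm y - p).
  by move: h; rewrite /GRing.scale /=; lra.
by rewrite pmulr_rge0 ?mulr_gt0// subr_ge0.
Qed.

Lemma resolvent_bounded_below U z : resolvent_set U z ->
  exists2 k : R, 0 < k & forall x, k * hnorm x <= hnorm (U x - z *: x).
Proof.
move=> [B [[M hM] BK _]]; exists (`|M| + 1)^-1.
  by rewrite invr_gt0 ltr_wpDl.
move=> x; rewrite ler_pdivrMl ?ltr_wpDl//.
rewrite -{1}[x]BK; apply: le_trans (hM _) _.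
by rewrite ler_wpM2r ?hnorm_ge0// ler_wpDr// ler_norm.
Qed.

Lemma resolvent_eigen U z x : resolvent_set U z -> U x = z *: x -> x = 0.
Proof.
move=> [B [_ BK _]] e; rewrite -[x]BK.
by rewrite /= e subrr linear0.
Qed.

Lemma unitary_hnorm U x : unitary U -> hnorm (U x) = hnorm x.
Proof. by move=> [_ h]; apply: hnorm_eq; rewrite h. Qed.

(** Invariance of [herm] under [U] gives [e^(i (a - b)) <x, y> = <x, y>]. *)
Lemma unitary_eigen_orth U a b x y : unitary U -> expi a != expi b ->
  U x = expi a *: x -> U y = expi b *: y -> herm x y = 0.
Proof.
move=> [_ Uh] ab ex ey; have := Uh x y; rewrite ex ey hermZl hermZr conj_expi.
rewrite mulrA => /eqP; rewrite -subr_eq0 -{2}[herm x y]mul1r -mulrBl mulf_eq0.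
case/orP=> [|/eqP//]; rewrite subr_eq0 => /eqP e1; case/eqP: ab.
by rewrite -[LHS]mulr1 -(expiNK b) mulrA e1 mul1r.
Qed.

Definition orthonormal n (v : 'I_n -> HJ) :=
  forall i j, herm (v i) (v j) = (i == j)%:R.

Lemma herm_orthonormal_sum n (v : 'I_n -> HJ) (a b : 'I_n -> R[i]) :
  orthonormal v ->
  herm (\sum_i a i *: v i) (\sum_i b i *: v i) = \sum_i a i * conjc (b i).
Proof.
move=> ov; rewrite herm_suml; apply: eq_bigr => i _.
rewrite hermZl herm_sumr; congr (_ * _).
rewrite (bigD1 i)//= big1 ?addr0; first by rewrite hermZr ov eqxx mulr1.
by move=> j ji; rewrite hermZr ov eq_sym (negPf ji) mulr0.
Qed.

Lemma herm_orthonormal n (v : 'I_n -> HJ) (a : 'I_n -> R[i]) j :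
  orthonormal v -> herm (\sum_i a i *: v i) (v j) = a j.
Proof.
move=> ov; rewrite herm_suml (bigD1 j)//= big1 ?addr0.
  by rewrite hermZl ov eqxx mulr1.
by move=> i ij; rewrite hermZl ov (negPf ij) mulr0.
Qed.

Lemma orthonormal_lin_indep n (v : 'I_n -> HJ) : orthonormal v -> lin_indep v.
Proof.
by move=> ov c c0 i; rewrite -(herm_orthonormal c i ov) c0 herm0l.
Qed.

Lemma exists_row_kernel (F : fieldType) n m (G : 'M[F]_(n, m)) : (m < n)%N ->
  exists2 u : 'rV[F]_n, u != 0 & u *m G = 0.
Proof.
move=> mn; apply: contrapT => h.
have : row_free G.
  apply: inj_row_free => u uG; apply/eqP; apply: contrapT => u0.
  by apply: h; exists u => //; apply/negP.
by rewrite /row_free => /eqP e; have := rank_leq_col G; rewrite e leqNgt mn.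
Qed.

(** A relation between the rows of the coefficient matrix, unavoidable with more rows than columns,
    is a relation between the [v i]. *)
Lemma lin_indep_le_span n m (v : 'I_n -> HJ) (w : 'I_m -> HJ) : lin_indep v ->
  (forall i, exists c : 'I_m -> R[i], v i = \sum_j c j *: w j) -> (n <= m)%N.
Proof.
move=> vi /fin_all_exists[c hc]; rewrite leqNgt; apply/negP => mn.
have [u u0 uc] := exists_row_kernel (\matrix_(i, j) c i j) mn.
case/eqP: u0; apply/rowP => i; rewrite mxE; apply: (vi (fun i => u 0 i)).
under eq_bigr => k _ do rewrite hc scaler_sumr.
rewrite exchange_big /= big1// => j _.
under eq_bigr => k _ do rewrite scalerA.
rewrite -scaler_suml (_ : \sum_k _ = (u *m (\matrix_(i, j) c i j)) 0 j).
  by rewrite uc mxE scale0r.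
by rewrite !mxE; apply: eq_bigr => k _; rewrite mxE.
Qed.

(** The device for comparing dimensions: the matrix of the products [herm (v i) (w j)] has more rows
    than columns, hence a nonzero row kernel. *)
Lemma exists_orth n m (v : 'I_n -> HJ) (w : 'I_m -> HJ) : (m < n)%N ->
  lin_indep v -> exists c : 'I_n -> R[i],
    \sum_i c i *: v i != 0 /\ forall j, herm (\sum_i c i *: v i) (w j) = 0.
Proof.
move=> mn vi.
have [u u0 uc] := exists_row_kernel (\matrix_(i, j) herm (v i) (w j)) mn.
exists (fun i => u 0 i); split.
  apply: contraNneq u0 => /vi u0; apply/eqP/rowP => i.
  by rewrite mxE u0.
move=> j; have /matrixP/(_ 0 j) := uc; rewrite !mxE => <-.
by rewrite herm_suml; apply: eq_bigr => i _; rewrite hermZl mxE.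
Qed.

Lemma cdim_ge n (v : 'I_n -> HJ) (V : set HJ) : (forall i, V (v i)) ->
  lin_indep v -> (n%:R%:E <= cdim V)%E.
Proof. by move=> Vv vi; apply: ereal_sup_ubound; exists n => //; exists v. Qed.

Lemma cdim_le n (v : 'I_n -> HJ) (V : set HJ) :
  (forall x, V x -> exists c : 'I_n -> R[i], x = \sum_j c j *: v j) ->
  (cdim V <= n%:R%:E)%E.
Proof.
move=> hV; apply: ge_ereal_sup => _ [m [u [Vu ui]] <-].
rewrite lee_fin ler_nat; apply: (lin_indep_le_span ui) => i; exact: hV.
Qed.

End Unitary.

(** * Orthonormal families of eigenvectors and multiplicities *)

Section Eigenfamily.
Variables (R : realType) (H : completeNormedModType R).
Variable S : compatible_symplectic H.
Local Notation HJ := (complexified S).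
Implicit Types (x y : HJ) (U : {linear HJ -> HJ}) (D : set R).

Definition eigenfamily U D n (v : 'I_n -> HJ) (th : 'I_n -> R) :=
  [/\ forall i, D (th i), forall i, U (v i) = expi (pi + th i) *: v i
    & orthonormal v].

(** Completeness is the absence of a further orthogonal eigenvector, which is what a family of
    largest size provides; that the eigenspaces are spanned is derived from it. *)
Definition complete_eigenfamily U D n (v : 'I_n -> HJ) (th : 'I_n -> R) :=
  eigenfamily U D v th /\
  forall a x, D a -> U x = expi (pi + a) *: x ->
    (forall i, herm x (v i) = 0) -> x = 0.

Lemma mult_ge0 U a : (0 <= mult U a)%E.
Proof.
apply: ereal_sup_ubound; exists 0%N => //.
by exists (fun=> 0); split=> [[]//|c _ []].
Qed.

Lemma mult_ge_card U D n (v : 'I_n -> HJ) (th : 'I_n -> R) a :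
  eigenfamily U D v th ->
  ((#|[pred i | th i == a]|%:R : R)%:E <= mult U a)%E.
Proof.
move=> [_ ev ov].
apply: (@cdim_ge _ _ _ _ (fun k => v (enum_val k))).
  move=> k; have /eqP e : th (enum_val k) == a by exact: (enum_valP k).
  by rewrite /Ker /= ev e subrr.
apply: orthonormal_lin_indep => i j; rewrite ov.
by rewrite (inj_eq enum_val_inj).
Qed.

Lemma esum_card D n (th : 'I_n -> R) : (forall i, D (th i)) ->
  \esum_(a in D) (#|[pred i | th i == a]|%:R : R)%:E = n%:R%:E.
Proof.
move=> Dth.
transitivity (\esum_(a in D) \sum_(i < n) ((th i == a)%:R : R)%:E)%E.
  apply: eq_esum => a _; rewrite sumEFin -natr_sum; congr (_%:R%:E).
  by rewrite -sum1_card big_mkcond /=; apply: eq_bigr => i _; rewrite inE; case: eqP.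
rewrite esum_sum; last by move=> i j _ _; rewrite lee_fin ler0n.
rewrite (eq_bigr (fun=> (1 : R)%:E)).
  by rewrite sumEFin sumr_const card_ord.
move=> i _; rewrite -[RHS](@esum_set1 R R (th i) (fun=> (1 : R)%:E)) ?lee_fin//.
have -> : [set th i] = D `&` [set th i].
  by apply/seteqP; split => [a ->|a []].
rewrite esum_mkcondr; apply: eq_esum => a _.
by case: eqP => [<-|/eqP ne]; [rewrite mem_set|rewrite memNset// => /= e;
  rewrite e eqxx in ne].
Qed.

Lemma eigenfamily_le U D n (v : 'I_n -> HJ) (th : 'I_n -> R) :
  eigenfamily U D v th -> (n%:R%:E <= \esum_(a in D) mult U a)%E.
Proof.
move=> ev; have [Dth _ _] := ev; rewrite -(esum_card Dth).
by apply: le_esum => a _; exact: mult_ge_card ev.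
Qed.

Section Arc.
Variables (U : {linear HJ -> HJ}) (D : set R).
Hypothesis Uu : unitary U.
Hypothesis D_inj : forall a b, D a -> D b -> expi (pi + a) = expi (pi + b) -> a = b.

(** An eigenvector minus its components along the [v i] of the same angle is orthogonal to the whole
    family (by unitarity, for the other angles), hence 0 by completeness. *)
Lemma mult_eq_card n (v : 'I_n -> HJ) (th : 'I_n -> R) a :
  complete_eigenfamily U D v th -> D a ->
  mult U a = (#|[pred i | th i == a]|%:R : R)%:E.
Proof.
move=> [ef cf] Da; apply/eqP; rewrite eq_le (mult_ge_card _ ef) andbT.
have [Dth ev ov] := ef.
apply: (@cdim_le _ _ _ _ (fun k => v (enum_val k))) => x.
rewrite /Ker /= => /eqP; rewrite subr_eq0 => /eqP Ux.
exists (fun k => herm x (v (enum_val k))).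
rewrite -(big_enum_val (fun i => herm x (v i) *: v i)) /=.
apply/eqP; rewrite -subr_eq0; apply/eqP.
set y := x - _; apply: (cf a) => //.
  rewrite /y linearB linear_sum /= Ux scalerBr scaler_sumr; congr (_ - _).
  apply: eq_bigr => i /eqP <-.
  by rewrite linearZ_LR /= ev !scalerA mulrC.
move=> i; rewrite /y hermBl herm_suml.
have [ia|ia] := eqVneq (th i) a.
  have ip : i \in [pred i | th i == a] by rewrite inE ia.
  rewrite (bigD1 i ip) big1 /= ?addr0.
    by rewrite hermZl ov eqxx mulr1 subrr.
  by move=> j /andP[_ ji]; rewrite hermZl ov (negPf ji) mulr0.
rewrite big1 ?subr0.
  apply: (unitary_eigen_orth Uu _ Ux (ev i)).
  by apply: contra_neq ia => /D_inj ->.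
move=> j /eqP ja; rewrite hermZl ov.
by case: eqP => [ji|]; rewrite ?mulr0//; rewrite -ji ja eqxx in ia.
Qed.

Lemma esum_mult_complete n (v : 'I_n -> HJ) (th : 'I_n -> R) :
  complete_eigenfamily U D v th -> \esum_(a in D) mult U a = n%:R%:E.
Proof.
move=> cf; have [[Dth _ _] _] := cf; rewrite -(esum_card Dth).
by apply: eq_esum => a Da; exact: mult_eq_card cf Da.
Qed.

(** The finite total multiplicity bounds the size of all eigenfamilies. One of largest size is
    complete, since a further orthogonal eigenvector could be normalised and adjoined. *)
Lemma exists_complete_eigenfamily : (\esum_(a in D) mult U a < +oo)%E ->
  exists n (v : 'I_n -> HJ) (th : 'I_n -> R), complete_eigenfamily U D v th.
Proof.
move=> fin.
pose P n := `[< exists (v : 'I_n -> HJ) th, eigenfamily U D v th >].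
have P0 : exists n, P n.
  exists 0%N; apply/asboolP; exists (fun=> 0), (fun=> 0).
  by split; [case|case|move=> []].
have [M PM] : exists M, forall n, P n -> (n <= M)%N.
  have ge0 : (0 <= \esum_(a in D) mult U a)%E.
    by apply: esum_ge0 => a _; exact: mult_ge0.
  exists (Num.bound (fine (\esum_(a in D) mult U a))).
  move=> n /asboolP[v [th /eigenfamily_le]].
  rewrite -(@fineK _ (\esum_(a in D) mult U a)) ?ge0_fin_numE// lee_fin => le.
  rewrite -(ler_nat R); apply/ltW/(le_lt_trans le).
  by apply: archi_boundP; rewrite fine_ge0.
case: (ex_maxnP P0 PM) => n /asboolP[v [th ef]] nmax.
exists n, v, th; split => // a x Da Ux xv; apply/eqP/negPn/negP => x0.
have : P n.+1.
  have [Dth ev ov] := ef.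
  pose c := ((hnorm x)^-1)%:C.
  have hx := hnorm_gt0 x0.
  have cx : herm (c *: x) (c *: x) = 1.
    rewrite hermxx hnormZ ?invr_ge0 ?ltW// mulVf ?expr1n//.
    by rewrite gt_eqF.
  apply/asboolP.
  exists (fun k => if unlift ord0 k is Some i then v i else c *: x).
  exists (fun k => if unlift ord0 k is Some i then th i else a).
  split.
  - by move=> k; case: unliftP.
  - move=> k; case: unliftP => [i _|_]; first exact: ev.
    by rewrite linearZ_LR /= Ux !scalerA mulrC.
  move=> i j; case: unliftP => [i' ->|->]; case: unliftP => [j' ->|->].
  - by rewrite ov (inj_eq lift_inj).
  - by rewrite herm_conj hermZl xv mulr0 conjc0 eq_sym (negPf (neq_lift _ _)).
  - by rewrite hermZl xv mulr0 (negPf (neq_lift _ _)).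
  - by rewrite cx eqxx.
by move=> /nmax; rewrite ltnn.
Qed.

End Arc.
End Eigenfamily.

(** * Rayleigh quotients and the spectrum in an arc of the circle *)

Section ArcGap.
Variables (R : realType) (H : completeNormedModType R).
Variable S : compatible_symplectic H.
Local Notation HJ := (complexified S).
Implicit Types (x y : HJ) (U : {linear HJ -> HJ}).

Lemma scale_realE (a : R) x : a%:C *: x = (a *: (x : H) : H).
Proof.
have -> : a%:C *: x = (a *: (x : H) + 0 *: J S x : H) by [].
by rewrite scale0r addr0.
Qed.

Lemma exists_linear (K : nzRingType) (V V' : lmodType K) (f : V -> V') :
  linear f -> exists g : {linear V -> V'}, forall u, g u = f u.
Proof.
move=> lf; pose lfM := GRing.isLinear.Build K V V' *:%R f lf.
by exists (HB.pack_for {linear V -> V'} f lfM).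
Qed.

(** Passage to the underlying real space, where the results on symmetric operators apply. *)
Lemma exists_real_linear U : exists A : {linear H -> H}, forall x : H, A x = U x.
Proof.
apply: exists_linear => a x y.
have := linearP U a%:C x y; rewrite !scale_realE => <-.
by [].
Qed.

Lemma unitary_inverse U : unitary U ->
  exists V : {linear HJ -> HJ}, cancel V U /\ cancel U V.
Proof.
move=> Uu; have [Us _] := Uu; have [g gK] := choice Us.
have Uinj x y : U x = U y -> x = y.
  move=> /eqP; rewrite -subr_eq0 -linearB => /eqP e.
  apply/eqP; rewrite -subr_eq0; apply/negPn/negP => /hnorm_gt0.
  by rewrite -(unitary_hnorm _ Uu) e /hnorm normr0 ltxx.
have [|V hV] := @exists_linear R[i] HJ HJ g.
  by move=> a x y; apply: Uinj; rewrite linearP !gK.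
by exists V; split=> x; [rewrite hV gK|apply: Uinj; rewrite hV gK].
Qed.

Lemma unitary_rot (t : R) U : unitary U -> unitary (expi t \*: U).
Proof.
move=> [Us Uh]; split=> [y|x y] /=.
  have [x Ux] := Us (expi (- t) *: y); exists x.
  by rewrite /= Ux scalerA expiKN scale1r.
by rewrite hermZl hermZr mulrA conj_expi expiKN mul1r Uh.
Qed.

(** By polarization this is the zero set of [|x + u| - |x - u|], so continuity of the norm
    suffices. *)
Lemma closed_ip (u : H) : closed [set x : H | ip S x u = 0].
Proof.
have -> : [set x : H | ip S x u = 0] =
    (fun x : H => `|x + u| - `|x - u|) @^-1` [set x | x = 0].
  have e (x : H) : `|x + u| ^+ 2 - `|x - u| ^+ 2 = 4 * ip S x u.
    rewrite -!(ip_norm S) linearDl linearBl !linearDr !linearNr /=.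
    by rewrite (hermC (ip S) u x) expr0 mul1r /=; lra.
  apply/seteqP; split => x /= h.
    have /eqP := e x; rewrite h mulr0 subr_eq0 eqrXn2 ?normr_ge0//.
    by move/eqP ->; rewrite subrr.
  have := e x; move/eqP: h; rewrite subr_eq0 => /eqP ->.
  by rewrite subrr => /esym/eqP; rewrite mulf_eq0 pnatr_eq0 /= => /eqP.
apply: preimage_closed; last exact: closed_eq.
move=> x _; apply: cvgB; apply: cvg_norm.
  by apply: cvgD; [exact: cvg_id|exact: cvg_cst].
by apply: cvgB; [exact: cvg_id|exact: cvg_cst].
Qed.

Definition orth n (v : 'I_n -> HJ) : set H :=
  [set x : H | forall i, herm (x : HJ) (v i) = 0].

(** [herm x v] vanishes exactly when the real products of [x] with [v] and with [J v] do. *)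
Lemma closed_orth n (v : 'I_n -> HJ) : closed (orth v).
Proof.
have -> : orth v = \bigcap_(i in [set: 'I_n])
    ([set x : H | ip S x (v i) = 0] `&` [set x : H | ip S x (J S (v i)) = 0]).
  have JE (x y : H) : ip S x (J S y) = - omega S x y.
    by rewrite omega_compatible -[LHS]J_orthogonal J_square linearNr.
  apply/seteqP; split => x.
    move=> h i _ /=; rewrite JE; have := h i; rewrite /herm => -[-> h2].
    by rewrite h2.
  move=> h i; have [/= h1] := h i I; rewrite JE => h2.
  by rewrite /herm h1 h2.
by apply: closed_bigI => i _; apply: closedI; exact: closed_ip.
Qed.

Lemma linear_subspace_orth n (v : 'I_n -> HJ) : linear_subspace (orth v).
Proof.
split=> [i|a x y hx hy i]; first exact: herm0l.
have -> : (a *: x + y : H) = (a%:C *: (x : HJ) + (y : HJ) : HJ).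
  by rewrite scale_realE.
by rewrite hermDl hermZl hx hy mulr0 addr0.
Qed.

(** The factorization [(W - e^(-i psi)) (W - e^(i psi)) = W (W + W^-1 - 2 cos psi)] links the points
    [e^(i psi)] and [e^(-i psi)] for [W] to the value [cos psi] for [(W + W^-1) / 2]. *)
Lemma rot_factor (W V : {linear HJ -> HJ}) (mu psi : R) x :
  cancel V W -> cancel W V -> cos psi = mu ->
  W (W x - expi psi *: x) - expi (- psi) *: (W x - expi psi *: x) =
    W (W x + V x - (mu *+ 2)%:C *: x).
Proof.
move=> VK KV <-; rewrite -expiDN.
have -> : W (W x + V x - (expi psi + expi (- psi)) *: x) =
    W (W x) + x - (expi psi + expi (- psi)) *: W x.
  by rewrite (linearB W) (linearD W) VK (linearZ_LR W).
rewrite (linearB W) (linearZ_LR W) /= scalerBr scalerA expiNK scale1r scalerDl.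
move: (expi psi *: W x) (expi (- psi) *: W x) => p q.
by rewrite opprB opprD addrACA.
Qed.

Section Fixed.
Variables (U : {linear HJ -> HJ}) (a b : R).
Hypotheses (Uu : unitary U) (ab : a < b) (abpi : b - a < pi).
Let g := (a + b) / 2.
Let c := cos ((b - a) / 2).
Let W : {linear HJ -> HJ} := expi (- (pi + g)) \*: U.

Let Wu : unitary W. Proof. exact: unitary_rot. Qed.

Let WE x : W x = expi (- (pi + g)) *: U x. Proof. by []. Qed.

Lemma cos_arc_gt th : a < th < b -> c < cos (th - g).
Proof.
move=> /andP[ath thb].
have h : `|th - g| < (b - a) / 2 by rewrite ltr_norml /g; apply/andP; split; lra.
have h1 : 0 <= (b - a) / 2 by lra.
have h2 : (b - a) / 2 <= pi by move: ab abpi; lra.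
have h0 : `|th - g| <= pi by apply: ltW; exact: lt_le_trans h h2.
rewrite -(cos_norm (th - g)) ltr_cos// in_itv /= ?h1 ?normr_ge0//.
Qed.

Lemma arc_expi_inj s t : a <= s <= b -> a <= t <= b ->
  expi (pi + s) = expi (pi + t) -> s = t.
Proof.
move=> /andP[as_ sb] /andP[at_ tb] /expi_inj h.
apply: (@addrI _ pi); apply: h; rewrite opprD addrACA subrr add0r.
rewrite ltr_norml mulr2n; apply/andP; split; move: ab abpi; lra.
Qed.

(** [W] is diagonal on the span, so the form is the sum of the [cos (th i - g) |k i|^2]; the
    finitely many cosines exceed [c] by a common margin. *)
Lemma ip_eigenspace_ge n (v : 'I_n -> HJ) (th : 'I_n -> R) :
  eigenfamily U [set th | a < th < b] v th ->
  exists2 d : R, 0 < d & forall (k : 'I_n -> R[i]) x,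
    x = \sum_i k i *: v i -> (c + d) * hnorm x ^+ 2 <= ip S (W x) x.
Proof.
move=> [Dth ev ov].
have [d d0 hd] : exists2 d, 0 < d & forall i, c + d <= cos (th i - g).
  have [r r0 hr] := gap_below_seq [seq - cos (th i - g) | i <- enum 'I_n] (- c).
  exists r => // i; have := hr (- cos (th i - g)).
  rewrite ltrN2 cos_arc_gt; last exact: Dth.
  move=> /(_ (map_f _ (mem_enum _ i)) isT); lra.
exists d => // k x xE.
pose N i := complex.Re (k i) ^+ 2 + complex.Im (k i) ^+ 2.
have kk i : k i * conjc (k i) = (N i)%:C.
  by rewrite /N; case: (k i) => p q; apply/eqP; rewrite eq_complex /=;
    apply/andP; split; apply/eqP; ring.
have ReS (F : 'I_n -> R[i]) :
    complex.Re (\sum_i F i) = \sum_i complex.Re (F i).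
  by apply: (big_morph (@complex.Re R)) => [[? ?] [? ?]|].
have -> : hnorm x ^+ 2 = \sum_i N i.
  rewrite -[LHS]/(complex.Re (hnorm x ^+ 2)%:C) -hermxx xE.
  by rewrite herm_orthonormal_sum// ReS; apply: eq_bigr => i _; rewrite kk.
have -> : ip S (W x) x = \sum_i cos (th i - g) * N i.
  rewrite -Re_herm WE xE linear_sum scaler_sumr.
  have -> : \sum_i expi (- (pi + g)) *: U (k i *: v i) =
      \sum_i (expi (th i - g) * k i) *: v i.
    apply: eq_bigr => i _; rewrite linearZ_LR /= ev !scalerA; congr (_ *: _).
    have -> : th i - g = - (pi + g) + (pi + th i) by lra.
    by rewrite (expiD (- (pi + g)) (pi + th i)); ring.
  rewrite herm_orthonormal_sum// ReS; apply: eq_bigr => i _.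
  by rewrite -mulrA kk /expi /=; ring.
rewrite mulr_sumr; apply: ler_sum => i _; apply: ler_wpM2r => //.
by rewrite addr_ge0 ?sqr_ge0.
Qed.

(** The self-adjoint [A = (W + W^-1) / 2] has the real quadratic form of [W] and preserves the
    orthogonal complement [K] of the family. A value [cos psi >= c] of its form comes from the two
    arc points [g + psi] and [g - psi]; the exceptional values are the cosines of the angles in the
    family. *)
Lemma ip_orth_le n (v : 'I_n -> HJ) (th : 'I_n -> R) :
  complete_eigenfamily U [set th | a < th < b] v th ->
  resolvent_set U (expi (pi + a)) -> resolvent_set U (expi (pi + b)) ->
  (forall t, a <= t <= b -> spectrum U (expi (pi + t)) ->
    exists2 x, x != 0 & U x = expi (pi + t) *: x) ->
  exists2 d : R, 0 < d & forall x, (forall i, herm x (v i) = 0) ->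
    ip S (W x) x <= (c - d) * hnorm x ^+ 2.
Proof.
move=> [[Dth ev ov] cf] resa resb parc.
have [V [VK KV]] := unitary_inverse Wu.
have [A AE] := exists_real_linear (2^-1%:C \*: (W \+ V)).
have {}AE (x : HJ) : A x = 2^-1%:C *: (W x + V x) by rewrite AE.
have VW x y : ip S (V x) y = ip S x (W y).
  by rewrite -!Re_herm -(proj2 Wu) VK.
have ipA x y : ip S (A x) y = (ip S (W x) y + ip S x (W y)) / 2.
  rewrite AE -Re_herm hermZl hermDl.
  rewrite -VW -!Re_herm; case: (herm _ _) => p q; case: (herm _ _) => p' q' /=.
  by ring.
have AmuE mu x : W (W x + V x - (mu *+ 2)%:C *: x) =
    W (2%:C *: ((A x : HJ) - mu%:C *: x)).
  rewrite AE scalerBr !scalerA; congr (W (_ - _ *: _)).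
    rewrite -rmorphM /= divff ?pnatr_eq0// scale1r //.
  by rewrite -rmorphM /= mulr_natl.
pose K := orth v.
pose s := [seq cos (th i - g) | i <- enum 'I_n].
(* The resolvent conditions exclude eigenvectors at the ends of the arc, completeness of the family
   those inside. *)
have noeig t x : a <= t <= b -> U x = expi (pi + t) *: x -> K x -> x = 0.
  move=> /andP[at_ tb] Ux Kx.
  have [ta|ta] := eqVneq t a; first by apply: (resolvent_eigen resa); rewrite -ta.
  have [tb'|tb'] := eqVneq t b; first by apply: (resolvent_eigen resb); rewrite -tb'.
  by apply: (cf t) => //=; rewrite !lt_neqAle at_ tb tb' eq_sym ta.
(* A spectral point would be an eigenvalue at an angle distinct from every [th i], so its
   eigenvector would lie in [K]. *)
have res t : a <= t <= b -> cos (t - g) \notin s ->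
    resolvent_set U (expi (pi + t)).
  move=> atb ts; apply: contrapT => sp.
  have [x x0 Ux] := parc t atb sp; case/eqP: x0; apply: (noeig t) => // i.
  apply: (unitary_eigen_orth Uu _ Ux (ev i)).
  apply/eqP => /arc_expi_inj e; case/negP: ts; rewrite e//.
    by apply: map_f; rewrite mem_enum.
  by have /andP[/ltW -> /ltW ->] := Dth i.
have psiP mu : c <= mu <= 1 -> exists psi, [/\ cos psi = mu,
    a <= g + psi <= b & a <= g - psi <= b].
  move=> /andP[cmu mu1].
  have mu1' : -1 <= mu <= 1 by rewrite mu1 andbT (le_trans _ cmu)// cos_geN1.
  have ha0 : 0 <= (b - a) / 2 by move: ab; lra.
  have hapi : (b - a) / 2 <= pi by move: ab abpi; lra.
  exists (acos mu).
  have cosE : cos (acos mu) = mu by rewrite acosK// in_itv.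
  have : acos mu <= (b - a) / 2.
    rewrite leNgt; apply/negP; rewrite -ltr_cos ?in_itv/= ?acos_ge0 ?acos_lepi ?ha0//.
    by rewrite cosE ltNge cmu.
  have := acos_ge0 mu1'; move: (acos mu) cosE => psi cosE psi0 psile.
  by split => //; rewrite /g; apply/andP; split; move: psi0 psile ab; lra.
have Zbb (psi : R) : a <= g + psi <= b -> cos psi \notin s ->
    exists2 k : R, 0 < k & forall x, k * hnorm x <= hnorm (W x - expi psi *: x).
  move=> ar cs.
  have [|k k0 hk] := resolvent_bounded_below (res (g + psi) ar _).
    by rewrite addrAC subrr add0r.
  exists k => // x; rewrite -(hnorm_expi (pi + g) (W x - _)).
  rewrite scalerBr WE !scalerA expiKN scale1r -expiD -addrA; exact: hk.
(* Each [v i] is a multiple of [U (v i)], so isometry carries orthogonality over from [x] to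
   [W x]. *)
have WK x : K x -> K (W x).
  move=> Kx i; rewrite -[v i]scale1r -(expiKN (- (pi + th i))) opprK -scalerA -ev.
  by rewrite WE hermZl hermZr (proj2 Uu) Kx !mulr0.
have VKK x : K x -> K (V x).
  move=> Kx i; rewrite -(proj2 Wu) VK WE ev scalerA hermZr Kx mulr0 //.
suff [d d0 hd] : exists2 d, 0 < d &
    forall x : H, K x -> ip S (A x) x <= (c - d) * `|x| ^+ 2.
  exists d => // x Kx; have := hd x Kx.
  rewrite ipA (hermC (ip S) x (W x)) expr0 mul1r /=.
  by have -> : (ip S (W x) x + ip S (W x) x) / 2 = ip S (W x) x by lra.
apply: (@rayleigh_lt_of_no_eigenvector _ _ (ip S) (ip_norm S) K A c 1 s
  (linear_subspace_orth v) (@closed_orth _ v)).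
- move=> x Kx i; rewrite AE hermZl hermDl.
  by rewrite WK// VKK// addr0 mulr0.
- move=> x y; rewrite ipA (hermC (ip S) x (A y)) expr0 mul1r /= ipA.
  rewrite (hermC (ip S) (W y)) (hermC (ip S) y) !expr0 !mul1r /=.
  by rewrite addrC.
- move=> x _; rewrite ipA (hermC (ip S) x (W x)) expr0 mul1r /=.
  suff h (y : HJ) : - hnorm y ^+ 2 <= ip S (W y) y <= hnorm y ^+ 2.
    by have := h x; rewrite /hnorm => /andP[h1 h2]; apply/andP; split; lra.
  have eN : hnorm (- W y) = hnorm y.
    by rewrite -(unitary_hnorm y Wu) /hnorm normrN.
  have h1 := ip_le_hnorm (W y) y; have h2 := ip_le_hnorm (- W y) y.
  rewrite linearNl eN in h2; rewrite (unitary_hnorm y Wu) in h1.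
  by rewrite lerNl expr2 h1 h2.
- apply/negP => /mapP[i _]; apply/eqP; rewrite lt_eqF//.
  by apply: cos_arc_gt; exact: Dth.
(* [W - e^(i psi)] and [W - e^(-i psi)] are bounded below, hence so is their product, which is
   [2 W (A - cos psi)]. *)
- move=> mu /psiP[psi [<- ar1 ar2]] mus.
  have [k1 k10 hk1] := Zbb psi ar1 mus.
  have [|k2 k20 hk2] := Zbb (- psi) ar2 _; first by rewrite cosN.
  exists (k2 * k1 / 2); first by rewrite divr_gt0// mulr_gt0.
  suff h (y : HJ) :
      k2 * (k1 * hnorm y) <= 2 * hnorm ((A y : HJ) - (cos psi)%:C *: y).
    move=> x _; rewrite mulrAC ler_pdivrMr// -mulrA [leRHS]mulrC.
    by have := h x; rewrite scale_realE.
  rewrite -[leRHS]hnormZ// -[leRHS](unitary_hnorm _ Wu) -AmuE -(rot_factor y VK KV erefl).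
  by apply: le_trans (hk2 _); rewrite ler_pM2l.
- suff h mu (x : HJ) : c <= mu <= 1 -> K x -> A x = mu%:C *: x -> x = 0.
    by move=> mu x cmu Kx Ax; apply: (h mu) => //; rewrite Ax scale_realE.
  move=> /psiP[psi [<- ar1 ar2]] Kx Ax.
  (* [W x - e^(i psi) x] lies in [K] and solves the eigenvalue equation at [g - psi], hence is 0;
     then [x] solves the one at [g + psi]. *)
  have e : W (W x - expi psi *: x) = expi (- psi) *: (W x - expi psi *: x).
    apply/eqP; rewrite -subr_eq0 (rot_factor x VK KV erefl) AmuE Ax.
    by rewrite subrr scaler0 linear0.
  have WU t y : W y = expi t *: y -> U y = expi (pi + (g + t)) *: y.
    by move=> Wy; rewrite addrA expiD -scalerA -Wy WE scalerA expiKN scale1r.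
  apply: (noeig (g + psi)) => //; apply: (WU); apply/eqP; rewrite -subr_eq0.
  apply/eqP; apply: (noeig (g - psi)) => //; first exact: WU.
  by move=> i; rewrite hermBl (hermZl (expi psi)) (WK x Kx i) (Kx i) mulr0 subr0.
Qed.

End Fixed.
End ArcGap.

(** * Multiplicity in an arc along a continuous path *)

Section Path.
Variables (R : realType) (H : completeNormedModType R).
Variable S : compatible_symplectic H.
Local Notation HJ := (complexified S).
Implicit Types (x y : HJ) (U V : {linear HJ -> HJ}).

(** The arc meets the spectrum in finitely many eigenvalues of finite multiplicity, and its ends are
    free of spectrum. *)
Definition discrete_arc (a b : R) U :=
  [/\ unitary U, (\esum_(th in [set th | (a < th < b)%R]) mult U th < +oo)%E,
      resolvent_set U (expi (pi + a)), resolvent_set U (expi (pi + b))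
    & forall t, a <= t <= b -> spectrum U (expi (pi + t)) ->
        exists2 x, x != 0 & U x = expi (pi + t) *: x].

(** The radius [dl] comes from the two gaps of [U] alone; of the gaps of [V] just the sign enters,
    so no uniformity in [V] is required. *)
Lemma esum_mult_locally_constant (a b : R) U : a < b -> b - a < pi ->
  discrete_arc a b U ->
  exists2 dl : R, 0 < dl & forall V, discrete_arc a b V ->
    (forall x, hnorm (V x - U x) <= dl * hnorm x) ->
    \esum_(th in [set th | a < th < b]) mult V th =
      \esum_(th in [set th | a < th < b]) mult U th.
Proof.
move=> ab abpi; pose D := [set th | a < th < b].
have D_inj s t : D s -> D t -> expi (pi + s) = expi (pi + t) -> s = t.
  move=> /andP[/ltW s1 /ltW s2] /andP[/ltW t1 /ltW t2].
  by apply: (arc_expi_inj ab abpi); apply/andP.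
pose W V x := expi (- (pi + (a + b) / 2)) *: V x.
pose c := cos ((b - a) / 2).
have data V : discrete_arc a b V -> exists n (v : 'I_n -> HJ),
    [/\ \esum_(th in D) mult V th = n%:R%:E, orthonormal v,
      exists2 d : R, 0 < d & forall (k : 'I_n -> R[i]) x,
        x = \sum_i k i *: v i -> (c + d) * hnorm x ^+ 2 <= ip S (W V x) x
    & exists2 d : R, 0 < d & forall x, (forall i, herm x (v i) = 0) ->
        ip S (W V x) x <= (c - d) * hnorm x ^+ 2].
  move=> [Vu fin resa resb parc].
  have [n [v [th cf]]] := exists_complete_eigenfamily fin.
  have [[_ _ ov] _] := cf.
  exists n, v; split => //; first exact: (esum_mult_complete Vu D_inj cf).
    exact: (ip_eigenspace_ge ab abpi (proj1 cf)).
  exact: (ip_orth_le Vu ab abpi cf).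
move=> /data[n [v [-> ov [d1 d10 hd1] [d2 d20 hd2]]]].
exists (Num.min d1 d2); first by rewrite lt_min d10.
move=> V /data[m [w [-> ow [e1 e10 he1] [e2 e20 he2]]]] VU.
have diff x : `|ip S (W V x) x - ip S (W U x) x| <= Num.min d1 d2 * hnorm x ^+ 2.
  have WB : W V x - W U x = expi (- (pi + (a + b) / 2)) *: (V x - U x).
    by rewrite scalerBr.
  have h1 := ip_le_hnorm (W V x - W U x) x.
  have h2 := ip_le_hnorm (- (W V x - W U x)) x.
  have eN : hnorm (- (W V x - W U x)) = hnorm (W V x - W U x).
    by rewrite /hnorm normrN.
  rewrite linearNl eN in h2; rewrite -linearBl.
  have h3 : hnorm (W V x - W U x) * hnorm x <= Num.min d1 d2 * hnorm x ^+ 2.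
    by rewrite expr2 mulrA ler_wpM2r ?hnorm_ge0// WB hnorm_expi.
  by rewrite ler_norml lerNl (le_trans h2 h3) (le_trans h1 h3).
have min1 x : Num.min d1 d2 * hnorm x ^+ 2 <= d1 * hnorm x ^+ 2.
  by rewrite ler_wpM2r ?sqr_ge0// ge_min lexx.
have min2 x : Num.min d1 d2 * hnorm x ^+ 2 <= d2 * hnorm x ^+ 2.
  by rewrite ler_wpM2r ?sqr_ge0// ge_min lexx orbT.
congr (_%:R%:E); apply/eqP; rewrite eqn_leq; apply/andP; split.
  (* A nonzero combination [x] of the [w i] orthogonal to all [v i] has form above [c |x|^2] for [V]
     and at most [(c - d2) |x|^2] for [U], too far apart. The other inequality exchanges the roles
     and uses [d1]. *)
  rewrite leqNgt; apply/negP => nm.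
  have [k []] := exists_orth v nm (orthonormal_lin_indep ow).
  set x := \sum_i _ => /hnorm_gt0 x0 /hd2 h1.
  have h2 := he1 k x erefl; have := diff x; rewrite ler_norml => /andP[_ h3].
  have h4 := min2 x; have : 0 < e1 * hnorm x ^+ 2 by rewrite mulr_gt0 ?exprn_gt0.
  lra.
rewrite leqNgt; apply/negP => mn.
have [k []] := exists_orth w mn (orthonormal_lin_indep ov).
set x := \sum_i _ => /hnorm_gt0 x0 /he2 h1.
have h2 := hd1 k x erefl; have := diff x; rewrite ler_norml => /andP[h3 _].
have h4 := min1 x; have : 0 < e2 * hnorm x ^+ 2 by rewrite mulr_gt0 ?exprn_gt0.
lra.
Qed.

Lemma path_dist_le (d : R -> {linear HJ -> HJ}) (t r : R) :
  (forall s, 0 <= s <= 1 -> unitary (d s)) -> norm_continuous_path d ->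
  0 <= t <= 1 -> 0 < r ->
  exists2 dl : R, 0 < dl & forall s, 0 <= s <= 1 -> `|t - s| < dl ->
    forall x, hnorm (d s x - d t x) <= r * hnorm x.
Proof.
move=> du dc t01 r0.
have t01' : `[0, 1]%classic t by rewrite /= in_itv.
have /cvgrPdist_lt/(_ r r0) := dc t t01'.
rewrite near_withinE => -[dl dl0 hdl]; exists dl => // s s01 ts x.
have := hdl s ts; rewrite /= in_itv /= => /(_ s01).
rewrite sub0r normrN => /(le_lt_trans (ler_norm _)) opr.
have sup_le y : hnorm y <= 1 -> hnorm (d s y - d t y) <= r.
  move=> y1; apply: le_trans (ltW opr); apply: ub_le_sup; last by exists y.
  (* The supremum in [opnorm] dominates its members only for a set bounded above; unitarity supplies
     the bound 2. *)
  exists 2 => _ [z /= z1 <-].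
  have : hnorm (d s z - d t z) <= hnorm (d s z) + hnorm (d t z).
    by rewrite /hnorm; exact: ler_normB.
  rewrite (unitary_hnorm z (du _ s01)) (unitary_hnorm z (du _ t01)) => h.
  by apply: le_trans h _; lra.
have [->|x0] := eqVneq x 0.
  by rewrite (linear0 (d s)) (linear0 (d t)) subr0 /hnorm normr0 mulr0.
have hx := hnorm_gt0 x0; have hi : 0 <= (hnorm x)^-1 by rewrite invr_ge0 ltW.
have e (k : R[i]) : d s (k *: x) - d t (k *: x) = k *: (d s x - d t x).
  by rewrite (linearZ_LR (d s)) (linearZ_LR (d t)) scalerBr.
have := sup_le ((hnorm x)^-1%:C *: x).
rewrite e !hnormZ// mulVf ?gt_eqF// lexx => /(_ isT).
by rewrite ler_pdivrMl// mulrC.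
Qed.

(** Local constancy on a connected interval. *)
Lemma esum_mult_constant (d : R -> {linear HJ -> HJ}) (a b p q : R) :
  (forall s, 0 <= s <= 1 -> unitary (d s)) -> norm_continuous_path d ->
  0 <= p -> q <= 1 -> p <= q -> a < b -> b - a < pi ->
  (forall s, p <= s <= q -> discrete_arc a b (d s)) ->
  \esum_(th in [set th | a < th < b]) mult (d p) th =
    \esum_(th in [set th | a < th < b]) mult (d q) th.
Proof.
move=> du dc p0 q1 pq ab abpi good.
pose n s := \esum_(th in [set th | a < th < b]) mult (d s) th.
have s01 s : p <= s <= q -> 0 <= s <= 1.
  by move=> /andP[ps sq]; rewrite (le_trans p0 ps) (le_trans sq q1).
have loc s : p <= s <= q -> exists2 dl : R, 0 < dl &
    forall s', p <= s' <= q -> `|s - s'| < dl -> n s' = n s.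
  move=> spq; have [r r0 hr] := esum_mult_locally_constant ab abpi (good _ spq).
  have [dl dl0 hdl] := path_dist_le du dc (s01 _ spq) r0.
  exists dl => // s' s'pq ss'; apply: hr; first exact: good.
  by apply: hdl => //; exact: s01.
pose B := [set s | p <= s <= q /\ n s = n p].
(* [O P] is the union of the balls of local constancy around the points satisfying [P]. It cuts out
   of [[p, q]] the set [B] when [P] is the equality with [n p], and the complement of [B] when [P]
   is its negation. *)
pose O (P : R -> Prop) :=
  [set s' | exists s dl, [/\ p <= s <= q, P s, 0 < dl, `|s - s'| < dl &
    forall s', p <= s' <= q -> `|s - s'| < dl -> n s' = n s]].
have Oopen P : open (O P).
  rewrite openE => s' [s [dl [spq Ps dl0 ss' h]]].
  exists (dl - `|s - s'|); first by rewrite /= subr_gt0.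
  move=> u /= us'; exists s, dl; split => //.
  have -> : s - u = (s - s') + (s' - u) by rewrite addrA subrK.
  by apply: le_lt_trans (ler_normD _ _) _; rewrite addrC -ltrBrDr.
have BE : B = `[p, q]%classic.
  apply: (@segment_connected R p q).
  - by exists p; split => //; rewrite lexx pq.
  - exists (O (fun s => n s = n p)) => //; apply/seteqP; split => s.
      move=> [spq ns]; split; first by rewrite /= in_itv.
      have [dl dl0 hdl] := loc _ spq; exists s, dl; split => //.
      by rewrite subrr normr0.
    rewrite /= in_itv /= => -[spq [u [dl [upq nu dl0 us h]]]].
    by split => //; rewrite h.
  - exists (~` O (fun s => n s <> n p)); first exact: open_closedC.
    apply/seteqP; split => s.
      move=> [spq ns]; split; first by rewrite /= in_itv.
      by move=> [u [dl [upq nu dl0 us h]]]; apply: nu; rewrite -ns h.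
    rewrite /= in_itv /= => -[spq h]; split => //; apply: contrapT => ns.
    have [dl dl0 hdl] := loc _ spq; apply: h; exists s, dl; split => //.
    by rewrite subrr normr0.
have : `[p, q]%classic q by rewrite /= in_itv /= lexx pq.
by rewrite -BE => -[_ /esym].
Qed.

End Path.

(** * Common refinement of two partitions *)

Section Refinement.
Variable R : realType.

Lemma partition_mono (N : nat) (t : nat -> R) :
  (forall j, (1 <= j <= N)%N -> t j.-1 < t j) ->
  forall i j, (i <= j <= N)%N -> t i <= t j.
Proof.
move=> inc i; elim=> [|j IH] /andP[]; first by rewrite leqn0 => /eqP ->.
rewrite leq_eqVlt => /orP[/eqP -> //|ij jN].
apply: le_trans (IH _) _; first by rewrite -ltnS ij ltnW.
by apply: ltW; exact: (inc j.+1).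
Qed.

Let clamp (p q s : R) := Num.max p (Num.min s q).

Let clamp_lo p q s : p <= q -> s <= p -> clamp p q s = p.
Proof.
move=> pq sp; rewrite /clamp (min_idPl (le_trans sp pq)).
by rewrite (max_idPl sp).
Qed.

Let clamp_hi p q s : p <= q -> q <= s -> clamp p q s = q.
Proof. by move=> pq qs; rewrite /clamp (min_idPr qs) (max_idPr pq). Qed.

(* Each term of either sum is split at the points of the other partition,
   clamped to the interval at hand; the two double sums agree term by term. *)
Lemma partition_sum_eq (F : R -> R -> R)
    (N : nat) (t eps : nat -> R) (N' : nat) (t' eps' : nat -> R) :
  t 0%N = 0 -> t N = 1 -> (forall j, (1 <= j <= N)%N -> t j.-1 < t j) ->
  t' 0%N = 0 -> t' N' = 1 -> (forall k, (1 <= k <= N')%N -> t' k.-1 < t' k) ->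
  (forall j k, (1 <= j <= N)%N -> (1 <= k <= N')%N -> forall p q, p <= q ->
    t j.-1 <= p -> q <= t j -> t' k.-1 <= p -> q <= t' k ->
    F q (eps j) - F p (eps j) = F q (eps' k) - F p (eps' k)) ->
  \sum_(1 <= j < N.+1) (F (t j) (eps j) - F (t j.-1) (eps j)) =
  \sum_(1 <= k < N'.+1) (F (t' k) (eps' k) - F (t' k.-1) (eps' k)).
Proof.
have split M (u e : nat -> R) M' (u' : nat -> R) :
    u 0%N = 0 -> u M = 1 -> (forall j, (1 <= j <= M)%N -> u j.-1 < u j) ->
    u' 0%N = 0 -> u' M' = 1 ->
    \sum_(1 <= j < M.+1) (F (u j) (e j) - F (u j.-1) (e j)) =
    \sum_(0 <= j < M) \sum_(0 <= k < M')
      (F (clamp (u j) (u j.+1) (u' k.+1)) (e j.+1) -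
       F (clamp (u j) (u j.+1) (u' k)) (e j.+1)).
  move=> u0 u1 inc u'0 u'1; have mono := partition_mono inc.
  rewrite big_add1 /=; apply: eq_big_nat => j /andP[_ jM].
  rewrite (telescope_sumr (fun k => F (clamp (u j) (u j.+1) (u' k)) (e j.+1)))//.
  have uj : u j <= u j.+1 by apply: mono; rewrite leqnSn.
  have uj0 : 0 <= u j by rewrite -u0; apply: mono; rewrite leq0n ltnW.
  have uj1 : u j.+1 <= 1 by rewrite -u1; apply: mono; rewrite jM leqnn.
  by rewrite u'0 u'1 (clamp_lo uj uj0) (clamp_hi uj uj1).
move=> t0 t1 inc t'0 t'1 inc' FE.
rewrite (split _ _ _ N' t')// (split _ _ _ N t)// exchange_big_nat /=.
apply: eq_big_nat => k /andP[_ kN']; apply: eq_big_nat => j /andP[_ jN].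
have /= tj := inc j.+1 jN; have /= tk := inc' k.+1 kN'.
(* Without overlap of the two intervals both terms vanish; otherwise both clamped pairs are the ends
   of the overlap, [max (t j) (t' k)] and [min (t j.+1) (t' k.+1)]. *)
have [kj|jk] := leP (t' k.+1) (t j).
  rewrite !(@clamp_lo (t j)) ?(ltW tj)//; last exact: le_trans (ltW tk) kj.
  by rewrite !(@clamp_hi (t' k)) ?(ltW tk) ?subrr//; exact: le_trans kj (ltW tj).
have [jk'|kj'] := leP (t j.+1) (t' k).
  rewrite !(@clamp_hi (t j)) ?(ltW tj)//; last exact: le_trans jk' (ltW tk).
  by rewrite !(@clamp_lo (t' k)) ?(ltW tk) ?subrr//; exact: le_trans (ltW tj) jk'.
have e1 : clamp (t j) (t j.+1) (t' k.+1) = Num.min (t j.+1) (t' k.+1).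
  rewrite /clamp minC; apply/max_idPr.
  by rewrite le_min (ltW tj) (ltW jk).
have e2 : clamp (t' k) (t' k.+1) (t j.+1) = Num.min (t j.+1) (t' k.+1).
  by rewrite /clamp; apply/max_idPr; rewrite le_min (ltW kj') (ltW tk).
have e3 : clamp (t j) (t j.+1) (t' k) = Num.max (t j) (t' k).
  by rewrite /clamp (min_idPl (ltW kj')).
have e4 : clamp (t' k) (t' k.+1) (t j) = Num.max (t j) (t' k).
  by rewrite /clamp (min_idPl (ltW jk)) maxC.
rewrite e1 e2 e3 e4; apply: (FE j.+1 k.+1) => //=.
- by rewrite ge_max !le_min (ltW tj) (ltW jk) (ltW kj') (ltW tk).
- by rewrite le_max lexx.
- by rewrite ge_min lexx.
- by rewrite le_max lexx orbT.
- by rewrite ge_min lexx orbT.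
Qed.

End Refinement.

(** * Counts for two radii and independence of the choices *)

Section Count.
Variables (R : realType) (H : completeNormedModType R).
Variable S : compatible_symplectic H.
Local Notation HJ := (complexified S).
Implicit Types (U : {linear HJ -> HJ}).

Lemma esum_mult_subset U (A B : set R) : A `<=` B ->
  (\esum_(th in A) mult U th <= \esum_(th in B) mult U th)%E.
Proof.
move=> AB; rewrite (@esumID _ _ A B); last by move=> *; exact: mult_ge0.
rewrite (_ : B `&` A = A); last exact/setIidPr.
by rewrite leeDl// esum_ge0// => *; exact: mult_ge0.
Qed.

Lemma maslov_count_fin U e : finite_mult U e -> maslov_count U e \is a fin_num.
Proof.
move=> fin; rewrite ge0_fin_numE; last by apply: esum_ge0 => *; exact: mult_ge0.
apply: le_lt_trans fin; apply: esum_mult_subset => th /= /andP[th0 the].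
by rewrite ger0_norm.
Qed.

Lemma resolvent_mult0 U th : resolvent_set U (expi (pi + th)) -> mult U th = 0%E.
Proof.
move=> res; apply/eqP; rewrite eq_le mult_ge0 andbT.
apply: (@cdim_le _ _ _ 0 (fun=> 0)) => x; rewrite /Ker /= => /eqP.
rewrite subr_eq0 => /eqP /(resolvent_eigen res) ->.
by exists (fun=> 0); rewrite big_ord0.
Qed.

(** [[0, e']] consists of [[0, e]], []e, e'[] and the point [e'], whose multiplicity is 0 by the
    resolvent condition. *)
Lemma maslov_count_split U (e e' : R) : 0 <= e -> e < e' ->
  resolvent_set U (expi (pi + e')) ->
  maslov_count U e' =
    (maslov_count U e + \esum_(th in [set th | (e < th < e')%R]) mult U th)%E.
Proof.
move=> e0 ee' res; have pos A (th : R) : A th -> (0 <= mult U th)%E.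
  by move=> _; exact: mult_ge0.
have e1 : [set th | 0 <= th <= e'] `&` [set th | th <= e] =
    [set th | 0 <= th <= e].
  apply/seteqP; split => th /=; first by move=> [/andP[-> _] ->].
  by move=> /andP[-> h]; rewrite h (le_trans h (ltW ee')).
have e2 : [set th | 0 <= th <= e'] `&` ~` [set th | th <= e] `&`
    [set th | th < e'] = [set th | e < th < e'].
  apply/seteqP; split => th /=.
    by move=> [[/andP[_ _] /negP]]; rewrite -ltNge => -> ->.
  move=> /andP[h1 h2]; split => //; split; last by apply/negP; rewrite -ltNge.
  by rewrite (ltW h2) (le_trans e0 (ltW h1)).
have ID (A B : set R) := @esumID R R B A (mult U) (pos A).
rewrite /maslov_count [LHS](ID _ [set th | th <= e]) e1; congr (_ + _)%E.
rewrite (ID _ [set th | th < e']) e2 [X in (_ + X)%E]esum1 ?adde0//.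
move=> th /= [[/andP[_ the'] _] /negP]; rewrite -leNgt => e'th.
have -> : th = e' by apply/eqP; rewrite eq_le the' e'th.
exact: resolvent_mult0.
Qed.

Definition admissible U (e : R) :=
  [/\ resolvent_set U (expi (pi + e)), resolvent_set U (expi (pi - e)),
      finite_mult U e & point_arc U e].

Lemma maslov_count_diff (d : R -> {linear HJ -> HJ}) (e e' p q : R) :
  (forall s, 0 <= s <= 1 -> unitary (d s)) -> norm_continuous_path d ->
  0 <= p -> q <= 1 -> p <= q -> 0 < e < pi -> 0 < e' < pi ->
  (forall s, p <= s <= q -> admissible (d s) e) ->
  (forall s, p <= s <= q -> admissible (d s) e') ->
  fine (maslov_count (d q) e) - fine (maslov_count (d p) e) =
  fine (maslov_count (d q) e') - fine (maslov_count (d p) e').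
Proof.
move=> du dc p0 q1 pq; wlog ee' : e e' / e < e'.
  move=> hw he he' ad ad'; case: (ltgtP e e') => [h|h|->//]; first exact: hw.
  by symmetry; apply: hw.
move=> /andP[e0 epi] /andP[e'0 e'pi] ad ad'.
(* Each radius contributes one end in the resolvent set; finiteness and absence of other spectrum
   are inherited from the larger arc of radius [e']. *)
have disc s : p <= s <= q -> discrete_arc e e' (d s).
  move=> spq; have [rese _ _ _] := ad s spq.
  have [rese' _ fin parc] := ad' s spq.
  split => //.
  - by apply: du; case/andP: spq => ps sq; rewrite (le_trans p0 ps) (le_trans sq q1).
  - apply: le_lt_trans fin; apply: esum_mult_subset => th /= /andP[h1 h2].
    by rewrite ger0_norm ?(ltW h2)// (le_trans (ltW e0) (ltW h1)).
  - move=> th /andP[h1 h2]; apply: parc.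
    by rewrite ger0_norm// (le_trans (ltW e0) h1).
have pp : p <= p <= q by rewrite lexx pq.
have qq : p <= q <= q by rewrite lexx pq.
have split s : p <= s <= q -> fine (maslov_count (d s) e') =
    fine (maslov_count (d s) e) +
    fine (\esum_(th in [set th | (e < th < e')%R]) mult (d s) th).
  move=> spq; have [rese' _ _ _] := ad' s spq; have [_ _ fin _] := ad s spq.
  have [_ fin' _ _ _] := disc s spq.
  rewrite (maslov_count_split (ltW e0) ee' rese') fineD ?maslov_count_fin//.
  by rewrite ge0_fin_numE// esum_ge0// => *; exact: mult_ge0.
rewrite !split// (esum_mult_constant du dc p0 q1 pq ee' _ disc); last by lra.
ring.
Qed.

(** All counts in the data are finite, so the sum can be formed in [R], where it telescopes. *)
Lemma maslov_sumE (d : R -> {linear HJ -> HJ}) (N : nat) (t eps : nat -> R) :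
  maslov_data d N t eps ->
  maslov_sum d N t eps =
    (\sum_(1 <= j < N.+1) (fine (maslov_count (d (t j)) (eps j)) -
       fine (maslov_count (d (t j.-1)) (eps j))))%:E.
Proof.
move=> [_ _ inc _ ad]; rewrite /maslov_sum -sumEFin; apply: eq_big_nat => j.
rewrite ltnS => jN; have tj := ltW (inc j jN).
have [|_ _ f1 _] := ad j jN (t j); first by rewrite tj lexx.
have [|_ _ f2 _] := ad j jN (t j.-1); first by rewrite tj lexx.
by rewrite EFinB !fineK// maslov_count_fin.
Qed.

End Count.

Theorem proposition2p3 (R : realType) (H : completeNormedModType R)
    (S : compatible_symplectic H) (sepH : separable H)
    (d : R -> {linear complexified S -> complexified S})
    (dUF : forall t, 0 <= t <= 1 -> unitary_fredholm (d t))
    (dcont : norm_continuous_path d)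
    (N : nat) (t eps : nat -> R) (data : maslov_data d N t eps)
    (N' : nat) (t' eps' : nat -> R) (data' : maslov_data d N' t' eps') :
  maslov_sum d N t eps = maslov_sum d N' t' eps'.
Proof.
rewrite (maslov_sumE data) (maslov_sumE data'); congr (_%:E).
have [t0 t1 inc epi ad] := data; have [t'0 t'1 inc' epi' ad'] := data'.
(* On a common subinterval [[p, q]] both radii are admissible, so it remains to compare the
   increments of the two counts there. *)
apply: (@partition_sum_eq R (fun s e => fine (maslov_count (d s) e))) => //.
move=> j k jN kN' p q pq tp qt t'p qt'.
have j1 : (0 <= j.-1 <= N)%N by rewrite (leq_trans (leq_pred j)) //; case/andP: jN.
have jN1 : (j <= N <= N)%N by case/andP: jN => _ ->; rewrite leqnn.
apply: maslov_count_diff => //.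
- by move=> s /dUF[].
- by rewrite (le_trans _ tp)// -t0; apply: (partition_mono inc).
- by rewrite (le_trans qt)// -t1; apply: (partition_mono inc).
- exact: epi.
- exact: epi'.
- move=> s /andP[ps sq]; apply: ad => //.
  by rewrite (le_trans tp ps) (le_trans sq qt).
- move=> s /andP[ps sq]; apply: ad' => //.
  by rewrite (le_trans t'p ps) (le_trans sq qt').
Qed.
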